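(* Let $K$ be a field of characteristic $0$ and let $E=\bigsqcup_{n\ge1}E_n$ be a non-empty graded set with each $E_n$ finite. Let $I$ be the two-sided ideal of the free pre-Lie algebra $(\mathcal T^E,\to)$ generated by all elements $|s|(s\to t)+|t|(t\to s)$, $s,t\in T^E$. For every $t\in O(I)$ one has $$\widetilde\Psi_{S_{min}}(t)=Can\big(\widetilde\Psi_{S_{min}}(t),I\big)=t.$$ Moreover, the set $\widetilde{\mathcal B}:=\{\Phi(t):t\in O(I)\}$ is a monomial basis for the pre-Lie algebra $(\mathcal L(E),\rhd)$.
   Context: **Trees.** $T^E$ (resp. $T^E_{pl}$) is the set of non-planar (resp. planar) rooted trees with vertices decorated by $E$; $\mathcal T^E$, $\mathcal T^E_{pl}$ are their $K$-linear spans; $\pi:\mathcal T^E_{pl}\to\mathcal T^E$ forgets the planar embedding. $E_n=\{a^n_1,\dots,a^n_{d_n}\}$ is the set of generators of degree $n$; the degree $|t|$ of a tree is the sum of the degrees of the decorations of its vertices. $B_{+,a}(t_1\cdots t_k)$ is the tree with root decorated by $a$ and branches $t_1,\dots,t_k$ (in this order from left to right in the planar case). **Products.** Grafting on $\mathcal T^E$: $s\to t=\sum_{v\in V(t)}s\to_v t$, where $s\to_v t$ attaches the root of $s$ by a new edge to the vertex $v$ of $t$; $(\mathcal T^E,\to)$ is the free left pre-Lie algebra on the one-vertex trees. On $\mathcal T^E_{pl}$: the left Butcher product $\sigma\circ_{\searrow}B_{+,a}(\tau_1\cdots\tau_k)=B_{+,a}(\sigma\tau_1\cdots\tau_k)$,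 and the left grafting $\sigma\searrow\tau=\sum_{v\in V(\tau)}\sigma\searrow_v\tau$, where $\sigma\searrow_v\tau$ grafts $\sigma$ on $v$ as the new leftmost branch at $v$. $(\mathcal T^E_{pl},\circ_{\searrow})$ and $(\mathcal T^E_{pl},\searrow)$ are both free magmatic algebras on the one-vertex trees. **Orders.** Generators are ordered by $a^1_1<\cdots<a^1_{d_1}<a^2_1<\cdots<a^2_{d_2}<\cdots$. Let $b(\sigma)$ be the number of branches at the root. On $T^E_{pl}$, $\sigma\prec\tau$ iff: $|\sigma|<|\tau|$; or $|\sigma|=|\tau|$ and $b(\sigma)<b(\tau)$; or degrees and numbers of branches agree and the left-to-right sequence of root branches of $\sigma$ is strictly lexicographically smaller (recursively for $\prec$) than that of $\tau$; or degrees and sequences of branches agree and the root decoration of $\sigma$ is strictly smaller than that of $\tau$. On $T^E$, $\prec$ is defined by the same rules, where the branches $s_1\preceq\cdots\preceq s_k$ of a non-planar tree at its root are first listed in nondecreasing order. $\preceq$ means $\prec$ or $=$; both are total orders. **Maps.** $\Psi:(\mathcal T^E_{pl},\circ_{\searrow})\to(\mathcal T^E_{pl},\searrow)$ is the unique magmatic algebra homomorphism which is the identity on one-vertex trees. For $t\in T^E$, $S_{min}(t):=\min_{\preceq}\{\tau\in T^E_{pl}:\pi(\tau)=t\}$, extended linearly to $\mathcal T^E$. $\widetilde\Psi_{S_{min}}:=\pi\circ\Psi\circ S_{min}:\mathcal T^E\to\mathcal T^E$. $\mathcal L(E)$ is the free Lie algebra over $K$ on $E$, graded by degree, with the pre-Lie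 product $x\rhd y=\frac1{|x|}[x,y]$ ($x$ homogeneous of degree $|x|$, extended bilinearly). $\Phi:(\mathcal T^E,\to)\to(\mathcal L(E),\rhd)$ is the unique pre-Lie homomorphism sending the one-vertex tree decorated by $a$ to $a$ for all $a\in E$. **Leading terms.** For $0\neq f\in\mathcal T^E$, $T(f)$ is the $\preceq$-maximal tree occurring in $f$ with nonzero coefficient; $T(I)=\{T(f):0\ne f\in I\}$, $O(I)=T^E\setminus T(I)$. One has $\mathcal T^E=I\oplus \mathrm{Span}_K(O(I))$, and $Can(f,I)$ is the unique $g\in\mathrm{Span}_K(O(I))$ with $f-g\in I$. **Monomial basis.** A vector space basis each of whose elements is a monomial, i.e. an iterated product (with respect to $\rhd$, with some bracketing) of generators from $E$. *)

(* Defs.v *)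
From HB Require Import structures.
From mathcomp Require Import all_boot all_order all_algebra.
From mathcomp Require Import boolp classical_sets.
From mathcomp Require Import finmap monalg.

Set Implicit Arguments.
Unset Strict Implicit.
Unset Printing Implicit Defensive.

Import GRing.Theory.
Local Open Scope ring_scope.
Local Open Scope quotient_scope.

(** * Linear extension *)

HB.lock Definition linext (K : fieldType) (A : choiceType) (V : lmodType K)
  (h : A -> V) (f : {malg K[A]}) : V := \sum_(a <- msupp f) f@_a *: h a.
Arguments linext {K A V} h f.

HB.lock Definition bilext (K : fieldType) (A B : choiceType) (V : lmodType K)
  (h : A -> B -> V) (f : {malg K[A]}) (g : {malg K[B]}) : V :=
  linext (fun a => linext (h a) g) f.
Arguments bilext {K A B V} h f g.

Section LinearExtension.
Variable K : fieldType.

Lemma linext_is_linear (A : choiceType) (V : lmodType K) (h : A -> V) :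
  linear (linext h).
Proof.
have E (D : {fset A}) (f : {malg K[A]}) :
    fsubset (msupp f) D -> linext h f = \sum_(a <- D) f@_a *: h a.
  move=> le; rewrite unlock (big_fset_incl _ le) // => a _ /mcoeff_outdom ->.
  by rewrite scale0r.
move=> c x y; pose D := fsetU (msupp x) (msupp y).
have lx : fsubset (msupp x) D by exact: fsubsetUl.
have ly : fsubset (msupp y) D by exact: fsubsetUr.
have lxy : fsubset (msupp (c *: x + y)) D.
  apply: fsubset_trans (msuppD_le _ _) _; apply: fsetSU; exact: msuppZ_le.
rewrite (E D _ lx) (E D _ ly) (E D _ lxy) scaler_sumr -big_split /=.
by apply: eq_bigr => a _; rewrite mcoeffD mcoeffZ scalerDl scalerA.
Qed.

HB.instance Definition _ (A : choiceType) (V : lmodType K) (h : A -> V) :=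
  GRing.isLinear.Build K {malg K[A]} V *:%R (linext h)
    (linext_is_linear h).

Lemma linextU (A : choiceType) (V : lmodType K) (h : A -> V) (a : A) :
  linext h << a >> = h a.
Proof.
by rewrite unlock msuppU oner_eq0 big_seq_fset1 mcoeffUU scale1r.
Qed.

Lemma malgUZ (A : choiceType) (c : K) (a : A) :
  << c *g a >> = c *: << a >> :> {malg K[A]}.
Proof. by apply/malgP => b; rewrite mcoeffZ !mcoeffU mulrnAr mulr1. Qed.

Lemma malg_ind (A : choiceType) (P : {malg K[A]} -> Prop) :
  P 0 -> (forall x y, P x -> P y -> P (x + y)) ->
  (forall c a, P (c *: << a >>)) -> forall x, P x.
Proof.
move=> P0 PD PU x; rewrite (monalgE x).
by elim/big_ind: _ => // a _; rewrite malgUZ.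
Qed.

Lemma linextP (A : choiceType) (V : lmodType K) (h : A -> V) c x y :
  linext h (c *: x + y) = c *: linext h x + linext h y.
Proof. exact: linearP. Qed.

Section Bilext.
Variables (A B : choiceType) (V : lmodType K) (h : A -> B -> V).

Lemma bilextU a b : bilext h << a >> << b >> = h a b.
Proof. by rewrite bilext.unlock !linextU. Qed.

Lemma bilext_linearl c x y z :
  bilext h (c *: x + y) z = c *: bilext h x z + bilext h y z.
Proof. by rewrite bilext.unlock linextP. Qed.

Lemma bilext_linearr c x y z :
  bilext h z (c *: x + y) = c *: bilext h z x + bilext h z y.
Proof.
have lD f (u v : {malg K[A]}) : linext f (u + v) = linext f u + linext f v :> V.
  exact: linearD.
have lZ f e (u : {malg K[A]}) : linext f (e *: u) = e *: linext f u :> V.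
  exact: linearZ.
rewrite bilext.unlock; elim/malg_ind: z => [|z z' IH IH'|e a].
- by rewrite !linear0 ?scaler0 ?addr0.
- by rewrite !lD IH IH' scalerDr addrACA.
by rewrite !lZ !linextU linextP scalerDr !scalerA mulrC.
Qed.

Lemma bilextDl x y z : bilext h (x + y) z = bilext h x z + bilext h y z.
Proof. by rewrite -[x in LHS]scale1r bilext_linearl scale1r. Qed.
Lemma bilextDr x y z : bilext h z (x + y) = bilext h z x + bilext h z y.
Proof. by rewrite -[x in LHS]scale1r bilext_linearr scale1r. Qed.
Lemma bilext0l z : bilext h 0 z = 0.
Proof. by apply: (@addrI _ (bilext h 0 z)); rewrite -bilextDl !addr0. Qed.
Lemma bilext0r z : bilext h z 0 = 0.
Proof. by apply: (@addrI _ (bilext h z 0)); rewrite -bilextDr !addr0. Qed.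
Lemma bilextZl c x z : bilext h (c *: x) z = c *: bilext h x z.
Proof. by rewrite -[c *: x]addr0 bilext_linearl bilext0l addr0. Qed.
Lemma bilextZr c x z : bilext h z (c *: x) = c *: bilext h z x.
Proof. by rewrite -[c *: x]addr0 bilext_linearr bilext0r addr0. Qed.

End Bilext.

End LinearExtension.

(** * Generators *)

(* [d n] is the number of generators of degree [n.+1]; the generator
   a^(n+1)_(i+1) is [existT _ n i]. *)
Definition gen (d : nat -> nat) : Type := {n : nat & 'I_(d n)}.
HB.instance Definition _ d := Countable.on (gen d).

Definition gdeg d (a : gen d) : nat := (tag a).+1.

Definition glt d (a b : gen d) : bool :=
  (tag a < tag b)%N || (tag a == tag b) && (tagged a < tagged b)%N.

(** * Planar trees *)

(* [Node a ts] is B_{+,a}(ts), with the branches listed from left to right. *)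
Inductive ptree (E : Type) : Type := Node of E & seq (ptree E).

Section PTreeChoice.
Variable E : Type.

Definition proot (t : ptree E) : E := let: Node a _ := t in a.
Definition pbranches (t : ptree E) : seq (ptree E) := let: Node _ ts := t in ts.

Fixpoint ptree_enc (t : ptree E) : GenTree.tree E :=
  let: Node a ts := t in GenTree.Node 0 (GenTree.Leaf a :: map ptree_enc ts).

Fixpoint ptree_dec (g : GenTree.tree E) : option (ptree E) :=
  if g is GenTree.Node _ (GenTree.Leaf a :: gs)
  then Some (Node a (pmap ptree_dec gs)) else None.

Lemma ptree_encK : pcancel ptree_enc ptree_dec.
Proof.
rewrite /pcancel; fix IH 1 => -[a ts] /=; congr (Some (Node a _)).
by elim: ts => //= t ts IHts; rewrite IH /= IHts.
Qed.

End PTreeChoice.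

HB.instance Definition _ (E : countType) :=
  Countable.copy (ptree E) (pcan_type (@ptree_encK E)).

Lemma ptree_mem_ind (E : countType) (P : ptree E -> Prop) :
  (forall a ts, (forall t, t \in ts -> P t) -> P (Node a ts)) ->
  forall t, P t.
Proof.
move=> H; fix IH 1 => -[a ts]; apply: H.
elim: ts => [|t ts IHts] u; first (rewrite in_nil; discriminate).
rewrite in_cons => /orP[/eqP->|]; [exact: IH|exact: IHts].
Qed.

(** * Non-planar trees *)

(* Equality up to the planar embedding: the branches of one tree correspond, up
   to a permutation and recursively, to those of the other. *)
Fixpoint iso (E : countType) (s t : ptree E) : bool :=
  let: Node a ss := s in let: Node b ts := t in
  (a == b) && has (fun us => all2 (@iso E) ss us) (permutations ts).

Section Iso.
Variable E : countType.
Implicit Types s t u : ptree E.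

Lemma isoP a b (ss ts : seq (ptree E)) :
  reflect (a = b /\ exists2 us, perm_eq us ts & all2 (@iso E) ss us)
          (iso (Node a ss) (Node b ts)).
Proof.
apply: (iffP andP) => -[/eqP eab].
  by case/hasP => us; rewrite mem_permutations => ? ?; split=> //; exists us.
case=> us p h; split=> //.
by apply/hasP; exists us => //; rewrite mem_permutations.
Qed.

Lemma iso_refl : reflexive (@iso E).
Proof.
apply: ptree_mem_ind => a ts IH; apply/isoP; split=> //; exists ts => //.
elim: ts IH => //= t ts IHts IH; rewrite IH ?mem_head //= IHts // => u uts.
by apply: IH; rewrite in_cons uts orbT.
Qed.

Lemma all2_perm (T : eqType) (r : T -> T -> bool) (s s' t : seq T) :
  perm_eq s s' -> all2 r s t -> exists2 t', perm_eq t' t & all2 r s' t'.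
Proof.
case: s t => [|x0 s] t; first by rewrite perm_sym => /perm_nilP -> ?; exists t.
move: (x0 :: s) => {}s; rewrite perm_sym => /(perm_iotaP x0)[Is pIs ->] h.
have [/eqP sz r_st] : size s == size t /\
    forall i, (i < size s)%N -> r (nth x0 s i) (nth x0 t i).
  move: h; rewrite all2E => /andP[/eqP sz h]; split; first exact/eqP.
  move=> i lti; have := all_nthP (x0, x0) h i; rewrite size_zip -sz minnn.
  by rewrite nth_zip //= => /(_ lti).
exists [seq nth x0 t i | i <- Is]; first by apply/(perm_iotaP x0); exists Is; rewrite -?sz.
have: {subset Is <= iota 0 (size s)} by move=> i; rewrite (perm_mem pIs).
elim: Is {pIs h} => //= i Is IHIs sub; rewrite IHIs ?andbT => [|j jI].
  by apply: r_st; have := sub i (mem_head _ _); rewrite mem_iota.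
by apply: sub; rewrite in_cons jI orbT.
Qed.

Lemma all2_sub (T : eqType) (r r' : T -> T -> bool) (s t : seq T) :
  (forall x y, x \in s -> r x y -> r' x y) -> all2 r s t -> all2 r' s t.
Proof.
elim: s t => [|x s IH] [|y t] //= sub /andP[rxy h].
rewrite (sub x) ?mem_head //= IH // => u v us; apply: sub.
by rewrite in_cons us orbT.
Qed.

Lemma all2_flip (T : eqType) (r : T -> T -> bool) (s t : seq T) :
  all2 r s t -> all2 (fun x y => r y x) t s.
Proof. by elim: s t => [|x s IH] [|y t] //= /andP[-> /IH]. Qed.

Lemma iso_impl_sym s t : iso s t -> iso t s.
Proof.
move: s t; apply: ptree_mem_ind => a ss IH [b ts] /isoP[<- [us pus h]].
have h' : all2 (@iso E) us ss.
  apply: all2_flip; apply: all2_sub h => x y xs; exact: IH.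
have [ss' pss' h''] := all2_perm pus h'.
by apply/isoP; split=> //; exists ss'.
Qed.

Lemma iso_sym : symmetric (@iso E).
Proof. by move=> s t; apply/idP/idP; exact: iso_impl_sym. Qed.

Lemma iso_trans : transitive (@iso E).
Proof.
move=> t s u; move: s t u.
apply: ptree_mem_ind => a ss IH [b ts] [c ws] /isoP[<- [us pus h]].
move=> /isoP[<- [vs pvs h']]; rewrite perm_sym in pus.
have [vs' pvs' h''] := all2_perm pus h'.
apply/isoP; split=> //; exists vs'; first exact: perm_trans pvs' pvs.
elim: ss us vs' h h'' IH {pus pvs pvs'} =>
  [|s ss IHss] [|u us] [|v vs'] //= /andP[su h] /andP[uv h''] IH.
rewrite (IH s _ u v) ?mem_head //=; apply: IHss h h'' _ => x xs.
by apply: IH; rewrite in_cons xs orbT.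
Qed.

Canonical iso_equiv := EquivRel (@iso E) iso_refl iso_sym iso_trans.
Canonical iso_encModRel := defaultEncModRel (@iso E).
End Iso.

(* The quotient map [\pi_(tree E)] forgets the planar embedding. *)
Definition tree (E : countType) : Type := {eq_quot (@iso E)}.
HB.instance Definition _ (E : countType) := Countable.on (tree E).
HB.instance Definition _ (E : countType) := EqQuotient.on (tree E).

Definition pi (E : countType) (s : ptree E) : tree E := \pi_(tree E) s.

Definition vertex (E : countType) (a : E) : tree E := pi (Node a [::]).

(** * Degrees and orders *)

Section Orders.
Variable d : nat -> nat.
Local Notation E := (gen d).

Fixpoint pdeg (t : ptree E) : nat :=
  let: Node a ts := t in (gdeg a + sumn (map pdeg ts))%N.

Definition lexlt (T : eqType) (lt : rel T) : seq T -> seq T -> bool :=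
  fix lex s t := match s, t with
  | x :: s', y :: t' => lt x y || (x == y) && lex s' t'
  | _, _ => false
  end.

(* One step of the definition of both orders: [m], [n] are the degrees, [ss],
   [ts] the lists of branches, [a], [b] the decorations of the roots, and [lt]
   is the order on branches. *)
Definition prec_rules (T : eqType) (lt : rel T) (m n : nat) (ss ts : seq T)
    (a b : E) : bool :=
  [|| (m < n)%N,
      (m == n) && (size ss < size ts)%N,
      [&& m == n, size ss == size ts & lexlt lt ss ts]
    | [&& m == n, ss == ts & glt a b]].

Fixpoint plt (s t : ptree E) : bool :=
  let: Node a ss := s in let: Node b ts := t in
  prec_rules plt (pdeg s) (pdeg t) ss ts a b.

Definition ple (s t : ptree E) : bool := (s == t) || plt s t.

Lemma glt_irr (a : E) : glt a a = false.
Proof. by rewrite /glt !ltnn andbF. Qed.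

Lemma glt_trans : transitive (@glt d).
Proof.
move=> [m j] [n i] [p k]; rewrite /glt /=.
case/orP=> [h|/andP[/eqP e h]]; case/orP=> [h'|/andP[/eqP e' h']].
- by rewrite (ltn_trans h h').
- by apply/orP; left; rewrite -e'.
- by apply/orP; left; rewrite e.
- by subst m p; apply/orP; right; rewrite eqxx (ltn_trans h h').
Qed.

Lemma glt_total (a b : E) : a != b -> glt a b || glt b a.
Proof.
case: a b => [n i] [m j]; rewrite /glt /=; case: (ltngtP n m) => //= e.
by subst m; rewrite eq_Tagged /= -val_eqE /= neq_ltn.
Qed.

Section LexTheory.
Variables (T : eqType) (lt : rel T).
Implicit Types s t u : seq T.

Lemma lexlt_irr s : (forall x, x \in s -> lt x x = false) -> lexlt lt s s = false.
Proof.
elim: s => //= x s IH H; rewrite H ?mem_head //= eqxx /= IH // => y ys.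
by apply: H; rewrite in_cons ys orbT.
Qed.

Lemma lexlt_trans s t u :
  (forall x y z, x \in s -> lt x y -> lt y z -> lt x z) ->
  lexlt lt s t -> lexlt lt t u -> lexlt lt s u.
Proof.
elim: s t u => [|x s IH] [|y t] [|z u] //= H.
case/orP=> [xy|/andP[/eqP <- h]]; case/orP=> [yz|/andP[/eqP e h']].
- by rewrite (H _ _ _ _ xy yz) ?mem_head.
- by rewrite -e xy.
- by rewrite yz.
- rewrite -e eqxx (IH _ _ _ h h') ?orbT // => a b c as_; apply: H.
  by rewrite in_cons as_ orbT.
Qed.

Lemma lexlt_total s t : (forall x y, x \in s -> x != y -> lt x y || lt y x) ->
  size s = size t -> s != t -> lexlt lt s t || lexlt lt t s.
Proof.
elim: s t => [|x s IH] [|y t] //= H [sz]; rewrite eqseq_cons.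
case: (eqVneq x y) => [<-|xy _] /=; last first.
  by have /orP[->|->] := H _ _ (mem_head _ _) xy; rewrite ?orbT.
move=> st; have /orP[->|->] : lexlt lt s t || lexlt lt t s; rewrite ?orbT //.
by apply: IH => // a b as_; apply: H; rewrite in_cons as_ orbT.
Qed.

Lemma prec_rules_irr m s a : (forall x, x \in s -> lt x x = false) ->
  prec_rules lt m m s s a a = false.
Proof.
by move=> H; rewrite /prec_rules !ltnn lexlt_irr // glt_irr !andbF.
Qed.

Lemma prec_rules_trans m n p s t u a b c :
  (forall x y z, x \in s -> lt x y -> lt y z -> lt x z) ->
  prec_rules lt m n s t a b -> prec_rules lt n p t u b c ->
  prec_rules lt m p s u a c.
Proof.
move=> H.
case/or4P=> [h1|/andP[/eqP-> h1]|/and3P[/eqP-> /eqP f1 h1]|/and3P[/eqP-> /eqP f1 h1]];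
case/or4P=> [h2|/andP[/eqP<- h2]|/and3P[/eqP<- /eqP f2 h2]|/and3P[/eqP<- /eqP f2 h2]];
apply/or4P; first [ by constructor 1 | by constructor 1; exact: ltn_trans h1 h2 | idtac ].
- by constructor 2; rewrite eqxx (ltn_trans h1 h2).
- by constructor 2; rewrite eqxx -f2.
- by constructor 2; rewrite eqxx -f2.
- by constructor 2; rewrite eqxx f1.
- by constructor 3; rewrite eqxx f1 f2 eqxx; exact: lexlt_trans h1 h2.
- by constructor 3; rewrite eqxx f1 -f2 eqxx.
- by constructor 2; rewrite eqxx f1.
- by constructor 3; rewrite eqxx f1 f2 eqxx.
- by constructor 4; rewrite eqxx f1 f2 eqxx (glt_trans h1 h2).
Qed.

Lemma prec_rules_total m n s t a b :
  (forall x y, x \in s -> x != y -> lt x y || lt y x) ->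
  (s != t) || (a != b) ->
  prec_rules lt m n s t a b || prec_rules lt n m t s b a.
Proof.
rewrite /prec_rules (eq_sym t s) => H ne; case: (ltngtP m n) => //= _.
case: (ltngtP (size s) (size t)) => sz /=; rewrite ?orbT //.
case: (eqVneq s t) ne => /= [_ ab|st _].
  by have /orP[->|->] := glt_total ab; rewrite !orbT.
by have /orP[->|->] := lexlt_total H sz st; rewrite ?orbT.
Qed.

End LexTheory.

Lemma plt_irr s : plt s s = false.
Proof. by elim/ptree_mem_ind: s => a ts IH; exact: prec_rules_irr. Qed.

Lemma plt_trans : transitive plt.
Proof.
move=> t s u; elim/ptree_mem_ind: s t u => a ss IH [b ts] [c us].
by apply: prec_rules_trans => x y z xs; exact: IH.
Qed.

Lemma plt_total s t : s != t -> plt s t || plt t s.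
Proof.
elim/ptree_mem_ind: s t => a ss IH [b ts] ne.
apply: prec_rules_total => [x y xs|]; first exact: IH.
by rewrite -negb_and; apply: contraNN ne => /andP[/eqP-> /eqP->].
Qed.

Lemma ple_refl : reflexive ple. Proof. by move=> s; rewrite /ple eqxx. Qed.

Lemma ple_trans : transitive ple.
Proof.
move=> t s u /orP[/eqP->//|st] /orP[/eqP<-|tu]; rewrite /ple ?st ?orbT //.
by rewrite (plt_trans st tu) orbT.
Qed.

Lemma ple_anti : antisymmetric ple.
Proof.
move=> s t /andP[/orP[/eqP//|st] /orP[/eqP//|ts]].
by have := plt_trans st ts; rewrite plt_irr.
Qed.

Lemma ple_total : total ple.
Proof.
move=> s t; rewrite /ple (eq_sym t s); case: eqVneq => //= st.
exact: plt_total.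
Qed.

(* The planar form of a tree in which, at every vertex, the branches are listed
   in nondecreasing order. *)
Fixpoint psort (t : ptree E) : ptree E :=
  let: Node a ts := t in Node a (sort ple (map psort ts)).

Definition deg (t : tree E) : nat := pdeg (repr t).

Definition tlt (s t : tree E) : bool := plt (psort (repr s)) (psort (repr t)).
Definition tle (s t : tree E) : bool := (s == t) || tlt s t.

Definition troot (t : tree E) : E := proot (repr t).
Definition tbranches (t : tree E) : seq (tree E) :=
  sort tle (map (@pi E) (pbranches (repr t))).

Lemma iso_psort_eq s t : iso s t -> psort s = psort t.
Proof.
elim/ptree_mem_ind: s t => a ss IH [b ts] /isoP[<- [us pus h]] /=.
congr Node; apply/(perm_sortP ple_total ple_trans ple_anti).
apply: (@perm_trans _ (map psort us)); last exact: perm_map.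
suff -> : map psort ss = map psort us by [].
elim: ss us h IH {pus} => [|s ss IHss] [|u us] //= /andP[su h] IH.
rewrite (IH s _ u) ?mem_head // (IHss us) // => x xs.
by apply: IH; rewrite in_cons xs orbT.
Qed.

Lemma iso_psort t : iso t (psort t).
Proof.
elim/ptree_mem_ind: t => a ts IH /=; apply/isoP; split=> //.
exists (map psort ts); first by rewrite perm_sym perm_sort.
elim: ts IH => //= t ts IHts IH; rewrite IH ?mem_head // IHts // => u uts.
by apply: IH; rewrite in_cons uts orbT.
Qed.

Lemma piP (s t : ptree E) : reflect (pi s = pi t) (iso s t).
Proof. exact: eqmodP. Qed.

Lemma pi_psort t : pi (psort t) = pi t.
Proof. by apply/piP; rewrite iso_sym iso_psort. Qed.

Lemma psort_repr_pi t : psort (repr (pi t)) = psort t.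
Proof. by apply: iso_psort_eq; apply/piP; rewrite /pi reprK. Qed.

Lemma psort_repr_inj : injective (fun t : tree E => psort (repr t)).
Proof.
move=> s t e; rewrite -(reprK s) -(reprK t) -[LHS]pi_psort -[RHS]pi_psort.
by congr pi.
Qed.

Lemma pdeg_psort t : pdeg (psort t) = pdeg t.
Proof.
elim/ptree_mem_ind: t => a ts IH /=; congr (_ + _)%N.
rewrite (perm_sumn (perm_map pdeg (permEl (perm_sort ple _)))) -map_comp.
by congr sumn; apply/eq_in_map => t; exact: IH.
Qed.

Lemma prec_rules_map (T U : eqType) (f : T -> U) (lt : rel U) m n ss ts a b :
  injective f -> prec_rules lt m n (map f ss) (map f ts) a b =
                 prec_rules (relpre f lt) m n ss ts a b.
Proof.
move=> fI; rewrite /prec_rules !size_map (inj_eq (inj_map fI)).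
congr [|| _, _, [&& _, _ & _] | _].
by elim: ss ts => [|s ss IH] [|t ts] //=; rewrite IH (inj_eq fI).
Qed.

Lemma lexle_sort (ss : seq (ptree E)) :
  sort ple ss = ss \/ lexlt plt (sort ple ss) ss.
Proof.
have := sort_sorted ple_total ss; have : perm_eq (sort ple ss) ss by rewrite perm_sort.
move: (sort ple ss) => m; elim: m ss => [|x m IH] [|y l].
- by left.
- by move/perm_size.
- by move/perm_size.
move=> p /= pm; have xy : ple x y.
  have : y \in x :: m by rewrite (perm_mem p) mem_head.
  rewrite in_cons => /orP[/eqP->|]; first exact: ple_refl.
  exact: (allP (order_path_min ple_trans pm)).
case/orP: xy => [/eqP e|->]; last by right.
rewrite e in p *; rewrite perm_cons in p.
case: (IH l p (path_sorted pm)) => [->|->]; [by left|right].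
by rewrite eqxx orbT.
Qed.

Lemma lexlt_eq_trans (s t u : seq (ptree E)) :
  s = t \/ lexlt plt s t -> t = u \/ lexlt plt t u -> s = u \/ lexlt plt s u.
Proof.
case=> [->//|st] [<-|tu]; right=> //; apply: lexlt_trans st tu => x y z _ xy.
exact: plt_trans.
Qed.

Lemma psort_ple s : ple (psort s) s.
Proof.
elim/ptree_mem_ind: s => a ts IH.
have : sort ple (map psort ts) = ts \/ lexlt plt (sort ple (map psort ts)) ts.
  apply: lexlt_eq_trans (lexle_sort _) _.
  elim: ts IH => [|t ts IHts] IH; first by left.
  have /orP[/eqP e|h] := IH t (mem_head _ _); last by right; rewrite /= h.
  case: IHts => [u uts|e'|h] /=; first by apply: IH; rewrite in_cons uts orbT.
    by left; rewrite e e'.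
  by right; rewrite e eqxx h orbT.
case=> [e|h]; first by rewrite /ple /= e eqxx.
apply/orP; right; apply/or4P; constructor 3.
by rewrite -/(psort (Node a ts)) pdeg_psort eqxx size_sort size_map eqxx.
Qed.

Lemma iso_psort_ple s t : iso s t -> ple (psort s) t.
Proof. by move/iso_psort_eq->; exact: psort_ple. Qed.

(* [tlt] obeys the recursive rules on non-planar trees, where [tbranches t] is
   the list of the branches of [t] at its root in nondecreasing order. *)
Lemma tltE s t : tlt s t =
  prec_rules tlt (deg s) (deg t) (tbranches s) (tbranches t) (troot s) (troot t).
Proof.
have br (u : tree E) : psort (repr u) =
    Node (troot u) [seq psort (repr v) | v <- tbranches u].
  rewrite /troot /tbranches; case: (repr u) => a us /=; congr Node.
  have -> : tle = relpre (fun v => psort (repr v)) ple.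
    by apply/funext => x; apply/funext => y;
       rewrite /tle /ple /= (inj_eq psort_repr_inj).
  rewrite -sort_map -!map_comp; congr sort; apply/eq_in_map => v _ /=.
  by rewrite psort_repr_pi.
have dg (u : tree E) : deg u =
    pdeg (Node (troot u) [seq psort (repr v) | v <- tbranches u]).
  by rewrite -br pdeg_psort.
rewrite {1}/tlt {1}(br s) {1}(br t).
rewrite [LHS](_ : _ = prec_rules plt (deg s) (deg t)
    [seq psort (repr v) | v <- tbranches s]
    [seq psort (repr v) | v <- tbranches t] (troot s) (troot t)); last by rewrite !dg.
by rewrite (prec_rules_map _ _ _ _ _ _ _ psort_repr_inj).
Qed.

End Orders.

(** * Products on trees *)

Section Products.
Variables (K : fieldType) (E : countType).

(* The sequences obtained from [ts] by replacing one of its members [t] by a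
   member of [f t]. *)
Definition graft_one (T : Type) (f : T -> seq T) : seq T -> seq (seq T) :=
  fix go ts := if ts is t :: ts' then
    [seq u :: ts' | u <- f t] ++ [seq t :: us | us <- go ts'] else [::].

(* The trees obtained by grafting [s] as the new leftmost branch at a vertex of
   [t], one for each vertex, the root coming first. *)
Fixpoint grafts (s t : ptree E) : seq (ptree E) :=
  let: Node a ts := t in
  Node a (s :: ts) :: [seq Node a us | us <- graft_one (grafts s) ts].

Definition lgraft : {malg K[ptree E]} -> {malg K[ptree E]} -> {malg K[ptree E]} :=
  bilext (fun s t => \sum_(u <- grafts s t) << u >>).

Definition butcher : {malg K[ptree E]} -> {malg K[ptree E]} -> {malg K[ptree E]} :=
  bilext (fun s t => << Node (proot t) (s :: pbranches t) >>).

(* The vertices of a non-planar tree are those of any of its planar forms, and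
   forgetting the planar embedding forgets the position of the new branch. *)
Definition graft : {malg K[tree E]} -> {malg K[tree E]} -> {malg K[tree E]} :=
  bilext (fun s t : tree E => \sum_(u <- grafts (repr s) (repr t)) << pi u >>).

Definition forget : {malg K[ptree E]} -> {malg K[tree E]} :=
  linext (fun s => << pi s >>).

(* B_{+,a}(t_1 ... t_k) = t_1 o (t_2 o (... (t_k o B_{+,a}()))) for the left
   Butcher product. *)
Fixpoint Psi_tree (t : ptree E) : {malg K[ptree E]} :=
  let: Node a ts := t in
  foldr (fun s f => lgraft (Psi_tree s) f) << Node a [::] >> ts.

Definition Psi : {malg K[ptree E]} -> {malg K[ptree E]} := linext Psi_tree.

Lemma PsiU t : Psi << t >> = Psi_tree t.
Proof. exact: linextU. Qed.

Lemma bilext_morph (A : choiceType) (V : lmodType K)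
    (h : A -> A -> {malg K[A]}) (k : V -> V -> V) (F : {linear {malg K[A]} -> V}) :
  (forall c x y z, k (c *: x + y) z = c *: k x z + k y z) ->
  (forall c x y z, k z (c *: x + y) = c *: k z x + k z y) ->
  (forall a b, F (h a b) = k (F << a >>) (F << b >>)) ->
  forall x y, F (bilext h x y) = k (F x) (F y).
Proof.
move=> kl kr H.
have k0l z : k 0 z = 0 by have := kl (-1) 0 0 z; rewrite scaler0 add0r scaleN1r addNr.
have k0r z : k z 0 = 0 by have := kr (-1) 0 0 z; rewrite scaler0 add0r scaleN1r addNr.
have kDl x y z : k (x + y) z = k x z + k y z by rewrite -[x]scale1r kl !scale1r.
have kDr x y z : k z (x + y) = k z x + k z y by rewrite -[x]scale1r kr !scale1r.
have kZl c x z : k (c *: x) z = c *: k x z by rewrite -[c *: x]addr0 kl k0l addr0.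
have kZr c x z : k z (c *: x) = c *: k z x by rewrite -[c *: x]addr0 kr k0r addr0.
move=> x y; elim/malg_ind: x => [|x x' IH IH'|c a].
- by rewrite bilext0l !linear0 k0l.
- by rewrite bilextDl !linearD IH IH' kDl.
rewrite bilextZl !linearZ /= kZl; congr (_ *: _).
elim/malg_ind: y => [|y y' IH IH'|e b].
- by rewrite bilext0r !linear0 k0r.
- by rewrite bilextDr !linearD IH IH' kDr.
by rewrite bilextZr !linearZ /= kZr bilextU H.
Qed.

Lemma PsiM x y : Psi (butcher x y) = lgraft (Psi x) (Psi y).
Proof.
apply: bilext_morph => [c u v w|c u v w|s [a ts]].
- exact: bilext_linearl.
- exact: bilext_linearr.
- change (Psi << Node a (s :: ts) >> = lgraft (Psi << s >>) (Psi << Node a ts >>)).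
  by rewrite !PsiU.
Qed.

End Products.

(** * Ideals *)

Inductive ideal_gen (K : fieldType) (V : lmodType K) (mul : V -> V -> V)
    (G : set V) : set V :=
| Ideal_gen x : G x -> ideal_gen mul G x
| Ideal_0 : ideal_gen mul G 0
| Ideal_D x y : ideal_gen mul G x -> ideal_gen mul G y -> ideal_gen mul G (x + y)
| Ideal_Z c x : ideal_gen mul G x -> ideal_gen mul G (c *: x)
| Ideal_l x y : ideal_gen mul G y -> ideal_gen mul G (mul x y)
| Ideal_r x y : ideal_gen mul G x -> ideal_gen mul G (mul x y).

(** * The free Lie algebra *)

(* The bracketings of generators form the basis of the free magmatic algebra;
   the free Lie algebra is its quotient by the ideal generated by the
   alternating and Jacobi relations. *)
Inductive magma (E : Type) : Type := Gen of E | Br of magma E & magma E.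

Section MagmaChoice.
Variable E : Type.

Fixpoint magma_enc (t : magma E) : GenTree.tree E :=
  match t with
  | Gen a => GenTree.Leaf a
  | Br l r => GenTree.Node 0 [:: magma_enc l; magma_enc r]
  end.

Fixpoint magma_dec (g : GenTree.tree E) : option (magma E) :=
  match g with
  | GenTree.Leaf a => Some (Gen a)
  | GenTree.Node _ [:: l; r] =>
      if magma_dec l is Some l' then
        if magma_dec r is Some r' then Some (Br l' r') else None
      else None
  | _ => None
  end.

Lemma magma_encK : pcancel magma_enc magma_dec.
Proof. by elim=> //= l -> r ->. Qed.

End MagmaChoice.

HB.instance Definition _ (E : countType) :=
  Countable.copy (magma E) (pcan_type (@magma_encK E)).

Section FreeLie.
Variables (K : fieldType) (E : countType).
Local Notation M := {malg K[magma E]}.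

Definition mmul : M -> M -> M := bilext (fun s t => << Br s t >>).

Lemma mmul_linearl c x y z : mmul (c *: x + y) z = c *: mmul x z + mmul y z.
Proof. exact: bilext_linearl. Qed.
Lemma mmul_linearr c x y z : mmul z (c *: x + y) = c *: mmul z x + mmul z y.
Proof. exact: bilext_linearr. Qed.
Lemma mmulDl x y z : mmul (x + y) z = mmul x z + mmul y z.
Proof. exact: bilextDl. Qed.
Lemma mmulDr x y z : mmul z (x + y) = mmul z x + mmul z y.
Proof. exact: bilextDr. Qed.
Lemma mmul0l z : mmul 0 z = 0. Proof. exact: bilext0l. Qed.
Lemma mmul0r z : mmul z 0 = 0. Proof. exact: bilext0r. Qed.
Lemma mmulZl c x z : mmul (c *: x) z = c *: mmul x z.
Proof. exact: bilextZl. Qed.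
Lemma mmulZr c x z : mmul z (c *: x) = c *: mmul z x.
Proof. exact: bilextZr. Qed.
Lemma mmulUU s t : mmul << s >> << t >> = << Br s t >>.
Proof. exact: bilextU. Qed.
Lemma mmulBl x y z : mmul (x - y) z = mmul x z - mmul y z.
Proof. by rewrite mmulDl -scaleN1r mmulZl scaleN1r. Qed.
Lemma mmulBr x y z : mmul z (x - y) = mmul z x - mmul z y.
Proof. by rewrite mmulDr -scaleN1r mmulZr scaleN1r. Qed.

Definition lie_rel : set M := [set r |
  (exists x, r = mmul x x) \/
  (exists x y z, r = mmul x (mmul y z) + mmul y (mmul z x) + mmul z (mmul x y))].

Definition lie_ideal : {pred M} := fun x => `[< ideal_gen mmul lie_rel x >].

Lemma lie_idealP x : reflect (ideal_gen mmul lie_rel x) (x \in lie_ideal).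
Proof. exact: asboolP. Qed.

Definition lie_equiv (x y : M) : bool := (x - y) \in lie_ideal.

Lemma lie_equiv_refl : reflexive lie_equiv.
Proof. by move=> x; apply/lie_idealP; rewrite subrr; exact: Ideal_0. Qed.

Lemma lie_equiv_impl x y : lie_equiv x y -> lie_equiv y x.
Proof.
move=> /lie_idealP h; apply/lie_idealP.
by rewrite -opprB -scaleN1r; exact: Ideal_Z.
Qed.

Lemma lie_equiv_sym : symmetric lie_equiv.
Proof. by move=> x y; apply/idP/idP; exact: lie_equiv_impl. Qed.

Lemma lie_equiv_trans : transitive lie_equiv.
Proof.
move=> y x z /lie_idealP h /lie_idealP h'; apply/lie_idealP.
by rewrite -[x](subrK y) -addrA; exact: Ideal_D.
Qed.

Canonical lie_equiv_equiv :=
  EquivRel lie_equiv lie_equiv_refl lie_equiv_sym lie_equiv_trans.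
Canonical lie_equiv_encModRel := defaultEncModRel lie_equiv.

Definition freeLie : Type := {eq_quot lie_equiv}.
HB.instance Definition _ := Choice.on freeLie.
HB.instance Definition _ := EqQuotient.on freeLie.

End FreeLie.

(* The operations on the quotient are locked to keep unification tractable. *)
HB.lock Definition lpi (K : fieldType) (E : countType) (x : {malg K[magma E]}) :
  freeLie K E := \pi_(freeLie K E) x.
Arguments lpi {K E} x.

HB.lock Definition lzero (K : fieldType) (E : countType) : freeLie K E := lpi 0.
Arguments lzero {K E}.

HB.lock Definition lopp (K : fieldType) (E : countType) (x : freeLie K E) :
  freeLie K E := lpi (- repr x).
Arguments lopp {K E} x.

HB.lock Definition ladd (K : fieldType) (E : countType) (x y : freeLie K E) :
  freeLie K E := lpi (repr x + repr y).
Arguments ladd {K E} x y.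

HB.lock Definition lscale (K : fieldType) (E : countType) (c : K)
  (x : freeLie K E) : freeLie K E := lpi (c *: repr x).
Arguments lscale {K E} c x.

Section FreeLieModule.
Variables (K : fieldType) (E : countType).
Local Notation M := {malg K[magma E]}.
Local Notation freeLie := (freeLie K E).
Local Notation lpi := (@lpi K E).
Local Notation lie_ideal := (@lie_ideal K E).

Lemma lpiP (x y : M) :
  reflect (lpi x = lpi y) (x - y \in lie_ideal).
Proof. by rewrite lpi.unlock; exact: eqmodP. Qed.

Lemma lpi_repr (x : freeLie) : lpi (repr x) = x.
Proof. by rewrite lpi.unlock reprK. Qed.

Lemma lpi_surj x : exists m, x = lpi m.
Proof. by exists (repr x); rewrite lpi_repr. Qed.

Lemma lpi_reprB (x : M) : ideal_gen (@mmul K E) (@lie_rel K E) (repr (lpi x) - x).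
Proof. by apply/lie_idealP/lpiP; rewrite lpi_repr. Qed.

Lemma lpi_opp x : lopp (lpi x) = lpi (- x).
Proof.
rewrite lopp.unlock; apply/lpiP/lie_idealP; rewrite -opprD -scaleN1r.
exact/Ideal_Z/lpi_reprB.
Qed.

Lemma lpi_add x y : ladd (lpi x) (lpi y) = lpi (x + y).
Proof.
rewrite ladd.unlock; apply/lpiP/lie_idealP; rewrite opprD addrACA.
by apply: Ideal_D; exact: lpi_reprB.
Qed.

Lemma lpi_scale c x : lscale c (lpi x) = lpi (c *: x).
Proof.
rewrite lscale.unlock; apply/lpiP/lie_idealP; rewrite -scalerBr.
exact/Ideal_Z/lpi_reprB.
Qed.

Lemma laddA : associative (@ladd K E).
Proof.
move=> x y z; case: (lpi_surj x) (lpi_surj y) (lpi_surj z) => [m ->] [n ->] [p ->].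
by rewrite !lpi_add addrA.
Qed.
Lemma laddC : commutative (@ladd K E).
Proof.
move=> x y; case: (lpi_surj x) (lpi_surj y) => [m ->] [n ->].
by rewrite !lpi_add addrC.
Qed.
Lemma ladd0 : left_id (@lzero K E) ladd.
Proof.
by move=> x; case: (lpi_surj x) => m ->; rewrite lzero.unlock lpi_add add0r.
Qed.
Lemma laddN : left_inverse (@lzero K E) lopp ladd.
Proof.
move=> x; case: (lpi_surj x) => m ->.
by rewrite lzero.unlock lpi_opp lpi_add addNr.
Qed.

HB.instance Definition _ := GRing.isZmodule.Build freeLie laddA laddC ladd0 laddN.

Lemma lpiD x y : lpi (x + y) = lpi x + lpi y.
Proof. by rewrite -lpi_add. Qed.

Lemma lscaleA a b (x : freeLie) : lscale a (lscale b x) = lscale (a * b) x.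
Proof. by case: (lpi_surj x) => m ->; rewrite !lpi_scale scalerA. Qed.
Lemma lscale1 : left_id 1 (@lscale K E).
Proof. by move=> x; case: (lpi_surj x) => m ->; rewrite lpi_scale scale1r. Qed.
Lemma lscaleDr : right_distributive (@lscale K E) +%R.
Proof.
move=> c x y; case: (lpi_surj x) (lpi_surj y) => [m ->] [n ->].
by rewrite -lpiD !lpi_scale -lpiD scalerDr.
Qed.
Lemma lscaleDl (x : freeLie) : {morph lscale^~ x : a b / a + b}.
Proof.
by move=> a b; case: (lpi_surj x) => m -> /=; rewrite !lpi_scale -lpiD scalerDl.
Qed.

HB.instance Definition _ :=
  GRing.Zmodule_isLmodule.Build K freeLie lscaleA lscale1 lscaleDr lscaleDl.

Lemma lpiZ c x : lpi (c *: x) = c *: lpi x.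
Proof. by rewrite -lpi_scale. Qed.

Lemma lpi_is_linear : linear lpi.
Proof. by move=> c x y; rewrite lpiD lpiZ. Qed.
HB.instance Definition _ := GRing.isLinear.Build K M freeLie *:%R lpi lpi_is_linear.

Lemma lpi_lin c x y : lpi (c *: x + y) = c *: lpi x + lpi y.
Proof. exact: lpi_is_linear. Qed.
Lemma lpi0 : lpi 0 = 0. Proof. exact: linear0. Qed.
Lemma lpi_eq0 x : ideal_gen (@mmul K E) (@lie_rel K E) x -> lpi x = 0.
Proof. by move=> Ix; rewrite -lpi0; apply/lpiP; rewrite subr0; apply/lie_idealP. Qed.

Definition lgen (a : E) : freeLie := lpi << Gen a >>.
End FreeLieModule.

HB.lock Definition lbr (K : fieldType) (E : countType) (x y : freeLie K E) :
  freeLie K E := lpi (mmul (repr x) (repr y)).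
Arguments lbr {K E} x y.

Section LieBracket.
Variables (K : fieldType) (E : countType).
Implicit Types x y z : freeLie K E.

Lemma lbr_pi (m n : {malg K[magma E]}) : lbr (lpi m) (lpi n) = lpi (mmul m n).
Proof.
move: m n => x y; rewrite lbr.unlock.
apply/lpiP.
have -> : mmul (repr (lpi x)) (repr (lpi y)) - mmul x y =
    mmul (repr (lpi x) - x) (repr (lpi y)) + mmul x (repr (lpi y) - y).
  by rewrite mmulBl mmulBr addrA subrK.
by apply/lie_idealP/Ideal_D; [apply: Ideal_r|apply: Ideal_l]; exact: lpi_reprB.
Qed.

Lemma lbr_linearl c x y z : lbr (c *: x + y) z = c *: lbr x z + lbr y z.
Proof.
case: (lpi_surj x) (lpi_surj y) (lpi_surj z) => [m ->] [n ->] [p ->].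
by rewrite -lpi_lin !lbr_pi mmul_linearl lpi_lin.
Qed.

Lemma lbr_linearr c x y z : lbr z (c *: x + y) = c *: lbr z x + lbr z y.
Proof.
case: (lpi_surj x) (lpi_surj y) (lpi_surj z) => [m ->] [n ->] [p ->].
by rewrite -lpi_lin !lbr_pi mmul_linearr lpi_lin.
Qed.

Lemma lbrxx x : lbr x x = 0.
Proof.
case: (lpi_surj x) => [m ->]; rewrite lbr_pi; apply: lpi_eq0.
by apply: Ideal_gen; left; exists m.
Qed.

Lemma lbr_jacobi x y z :
  lbr x (lbr y z) + lbr y (lbr z x) + lbr z (lbr x y) = 0.
Proof.
case: (lpi_surj x) (lpi_surj y) (lpi_surj z) => [m ->] [n ->] [p ->].
rewrite !lbr_pi -!lpiD; apply: lpi_eq0.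
by apply: Ideal_gen; right; exists m, n, p.
Qed.

End LieBracket.

(** * The pre-Lie product on the free Lie algebra *)

Section Degree.
Variables (K : fieldType) (d : nat -> nat).
Local Notation E := (gen d).
Local Notation M := {malg K[magma E]}.
Local Notation L := (freeLie K E).

Fixpoint mdeg (s : magma E) : nat :=
  match s with Gen a => gdeg a | Br l r => (mdeg l + mdeg r)%N end.

Definition hom (n : nat) (x : M) : Prop := forall s, s \in msupp x -> mdeg s = n.

(* The component of degree [n] of the free Lie algebra. *)
Definition homog (n : nat) (x : L) : Prop := exists2 m, hom n m & x = lpi m.

Definition invdeg : M -> M := linext (fun s => (mdeg s)%:R^-1 *: << s >>).

End Degree.

(* [x |> y] is [[x', y]], where [x'] is [x] with its component of degree [n]
   divided by [n], for all [n]; see [rhd_homog]. *)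
HB.lock Definition rhd (K : fieldType) (d : nat -> nat) (x y : freeLie K (gen d)) :
  freeLie K (gen d) := lpi (mmul (invdeg (repr x)) (repr y)).
Arguments rhd {K d} x y.

Section PreLie.
Variables (K : fieldType) (d : nat -> nat).
Local Notation E := (gen d).
Local Notation M := {malg K[magma E]}.
Local Notation L := (freeLie K E).
Local Notation mmul := (@mmul K E).
Local Notation rel := (@lie_rel K E).
Local Notation hom := (@hom K d).

Lemma hom0 n : hom n 0. Proof. by move=> s; rewrite msupp0. Qed.
Lemma homD n x y : hom n x -> hom n y -> hom n (x + y).
Proof.
move=> hx hy s /(fsubsetP (msuppD_le _ _)); rewrite in_fsetU => /orP[].
  exact: hx.
exact: hy.
Qed.
Lemma homZ n c x : hom n x -> hom n (c *: x).
Proof. by move=> hx s /(fsubsetP (msuppZ_le _ _)); exact: hx. Qed.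
Lemma homU s : hom (mdeg s) << s >>.
Proof. by move=> t /(fsubsetP msuppU_le); rewrite in_fset1 => /eqP->. Qed.

Lemma homM n m x y : hom n x -> hom m y -> hom (n + m) (mmul x y).
Proof.
move=> hx hy; rewrite /Defs.mmul bilext.unlock linext.unlock big_seq.
apply: (big_ind (hom (n + m))); [exact: hom0|exact: homD|move=> s sx].
apply: homZ; rewrite big_seq.
apply: (big_ind (hom (n + m))); [exact: hom0|exact: homD|move=> t ty].
by apply: homZ; rewrite -(hx s sx) -(hy t ty); exact: (@homU (Br s t)).
Qed.

Lemma invdeg_hom n x : hom n x -> invdeg x = n%:R^-1 *: x.
Proof.
move=> hx; rewrite {2}(monalgE x) scaler_sumr /invdeg linext.unlock.
by apply: eq_big_seq => s sx; rewrite (hx s sx) malgUZ !scalerA mulrC.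
Qed.

Inductive graded_ideal : M -> Prop :=
| Graded_hom n x : hom n x -> ideal_gen mmul rel x -> graded_ideal x
| Graded_D x y : graded_ideal x -> graded_ideal y -> graded_ideal (x + y).

Lemma graded0 : graded_ideal 0.
Proof. apply: (@Graded_hom 0); [exact: hom0|exact: Ideal_0]. Qed.

Lemma gradedZ c x : graded_ideal x -> graded_ideal (c *: x).
Proof.
elim=> [n y hy Iy|y z _ IHy _ IHz]; last by rewrite scalerDr; exact: Graded_D.
by apply: (@Graded_hom n); [exact: homZ|exact: Ideal_Z].
Qed.

Lemma graded_Ml x y : graded_ideal y -> graded_ideal (mmul x y).
Proof.
move=> Gy; elim/malg_ind: x => [|x x' IH IH'|c s].
- by rewrite mmul0l; exact: graded0.
- by rewrite mmulDl; exact: Graded_D.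
rewrite mmulZl; apply: gradedZ; elim: Gy => [n z hz Iz|z z' _ IH _ IH'].
  by apply: (Graded_hom (homM (@homU s) hz)); exact: Ideal_l.
by rewrite mmulDr; exact: Graded_D.
Qed.

Lemma graded_Mr x y : graded_ideal x -> graded_ideal (mmul x y).
Proof.
move=> Gx; elim/malg_ind: y => [|y y' IH IH'|c s].
- by rewrite mmul0r; exact: graded0.
- by rewrite mmulDr; exact: Graded_D.
rewrite mmulZr; apply: gradedZ; elim: Gx => [n z hz Iz|z z' _ IH _ IH'].
  by apply: (Graded_hom (homM hz (@homU s))); exact: Ideal_r.
by rewrite mmulDl; exact: Graded_D.
Qed.

Lemma ideal_sq x : ideal_gen mmul rel (mmul x x).
Proof. by apply: Ideal_gen; left; exists x. Qed.

Lemma ideal_anti x y : ideal_gen mmul rel (mmul x y + mmul y x).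
Proof.
have -> : mmul x y + mmul y x =
    mmul (x + y) (x + y) + (-1) *: mmul x x + (-1) *: mmul y y.
  rewrite mmulDl !mmulDr !scaleN1r.
  by rewrite -(addrA (mmul x x)) (addrC (mmul x x)) addrK addrA addrK.
by apply: Ideal_D; [apply: Ideal_D; [|apply: Ideal_Z]|apply: Ideal_Z];
   exact: ideal_sq.
Qed.

Lemma graded_anti x y : graded_ideal (mmul x y + mmul y x).
Proof.
elim/malg_ind: x => [|x x' IH IH'|c s].
- by rewrite mmul0l mmul0r addr0; exact: graded0.
- by rewrite mmulDl mmulDr addrACA; exact: Graded_D.
rewrite mmulZl mmulZr -scalerDr; apply: gradedZ.
elim/malg_ind: y => [|y y' IH IH'|c' t].
- by rewrite mmul0l mmul0r addr0; exact: graded0.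
- by rewrite mmulDl mmulDr addrACA; exact: Graded_D.
rewrite mmulZl mmulZr -scalerDr; apply: gradedZ.
apply: (@Graded_hom (mdeg s + mdeg t)); last exact: ideal_anti.
by apply: homD; [|rewrite addnC]; apply: homM; exact: homU.
Qed.

Lemma graded_sq x : graded_ideal (mmul x x).
Proof.
elim/malg_ind: x => [|x x' IH IH'|c s].
- by rewrite mmul0l; exact: graded0.
- have -> : mmul (x + x') (x + x') =
      mmul x x + mmul x' x' + (mmul x x' + mmul x' x).
    by rewrite mmulDl !mmulDr [RHS]addrACA (addrC (mmul x' x')).
  by apply: Graded_D; [exact: Graded_D|exact: graded_anti].
rewrite mmulZl mmulZr; do 2 apply: gradedZ.
by apply: (Graded_hom (homM (@homU s) (@homU s))); exact: ideal_sq.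
Qed.

Definition jac x y z :=
  mmul x (mmul y z) + mmul y (mmul z x) + mmul z (mmul x y).

Lemma jac_rot x y z : jac x y z = jac y z x.
Proof. by rewrite /jac -addrA addrC. Qed.

Lemma jac0l y z : jac 0 y z = 0.
Proof. by rewrite /jac !mmul0l !mmul0r !addr0. Qed.

Lemma jacDl x x' y z : jac (x + x') y z = jac x y z + jac x' y z.
Proof.
rewrite /jac !mmulDl !mmulDr.
by rewrite (addrACA (mmul x _)) [LHS]addrACA.
Qed.

Lemma jacZl c x y z : jac (c *: x) y z = c *: jac x y z.
Proof.
rewrite /jac (mmulZl c x (mmul y z)) (mmulZr c x z) (mmulZl c x y).
by rewrite (mmulZr c (mmul z x)) (mmulZr c (mmul x y)) !scalerDr.
Qed.

Lemma graded_jac x y z : graded_ideal (jac x y z).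
Proof.
elim/malg_ind: x => [|x x' IH IH'|c s].
- by rewrite jac0l; exact: graded0.
- by rewrite jacDl; exact: Graded_D.
rewrite jacZl jac_rot; apply: gradedZ.
elim/malg_ind: y => [|y y' IH IH'|c' t].
- by rewrite jac0l; exact: graded0.
- by rewrite jacDl; exact: Graded_D.
rewrite jacZl jac_rot; apply: gradedZ.
elim/malg_ind: z => [|z z' IH IH'|c'' r].
- by rewrite jac0l; exact: graded0.
- by rewrite jacDl; exact: Graded_D.
rewrite jacZl jac_rot; apply: gradedZ.
apply: (@Graded_hom (mdeg s + (mdeg t + mdeg r))); last first.
  by apply: Ideal_gen; right; do 3 eexists.
apply: homD; first apply: homD.
- by do 2 (apply: homM; first exact: homU); exact: homU.
- by rewrite addnCA [(mdeg s + _)%N]addnC; do 2 (apply: homM; first exact: homU); exact: homU.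
- by rewrite addnA addnC; do 2 (apply: homM; first exact: homU); exact: homU.
Qed.

Lemma ideal_graded x : ideal_gen mmul rel x -> graded_ideal x.
Proof.
elim=> {x} [x [[y ->]|[y [z [t ->]]]]||x y _ Gx _ Gy|c x _ Gx|x y _ Gy|x y _ Gx].
- exact: graded_sq.
- exact: graded_jac.
- exact: graded0.
- exact: Graded_D.
- exact: gradedZ.
- exact: graded_Ml.
- exact: graded_Mr.
Qed.

Lemma invdeg_lin c (x y : M) : invdeg (c *: x + y) = c *: invdeg x + invdeg y.
Proof. exact: linearP. Qed.

Lemma invdeg_ideal x : ideal_gen mmul rel x -> ideal_gen mmul rel (invdeg x).
Proof.
move/ideal_graded; elim=> {x} [n x hx Ix|x y _ Ix _ Iy].
  by rewrite (invdeg_hom hx); exact: Ideal_Z.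
rewrite -[x]scale1r invdeg_lin scale1r; exact: Ideal_D.
Qed.

Lemma rhd_pi (x y : M) : rhd (lpi x) (lpi y) = lpi (mmul (invdeg x) y).
Proof.
rewrite rhd.unlock -!lbr_pi lpi_repr; congr lbr; apply/lpiP.
have -> : invdeg (repr (lpi x)) - invdeg x = invdeg (repr (lpi x) - x).
  by rewrite -scaleN1r addrC -invdeg_lin scaleN1r addrC.
apply/lie_idealP; apply: invdeg_ideal.
by apply/lie_idealP/lpiP; rewrite lpi_repr.
Qed.

Lemma rhd_homog n (x y : L) : homog n x -> rhd x y = n%:R^-1 *: lbr x y.
Proof.
case=> m hm ->; case: (lpi_surj y) => [p ->].
rewrite rhd_pi (invdeg_hom hm) lbr_pi mmulZl.
by rewrite -[_ *: mmul m p]addr0 lpi_lin lpi0 addr0.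
Qed.

Lemma rhd_linearl c (x y z : L) : rhd (c *: x + y) z = c *: rhd x z + rhd y z.
Proof.
case: (lpi_surj x) (lpi_surj y) (lpi_surj z) => [m ->] [n ->] [p ->].
by rewrite -lpi_lin !rhd_pi invdeg_lin mmul_linearl lpi_lin.
Qed.

Lemma rhd_linearr c (x y z : L) : rhd z (c *: x + y) = c *: rhd z x + rhd z y.
Proof.
case: (lpi_surj x) (lpi_surj y) (lpi_surj z) => [m ->] [n ->] [p ->].
by rewrite -lpi_lin !rhd_pi mmul_linearr lpi_lin.
Qed.

End PreLie.

(** * The section S_min and the map Psi~ *)

Section Maps.
Variables (K : fieldType) (d : nat -> nat).
Local Notation E := (gen d).

(* The default value [repr t] plays no role: see [Smin_min]. *)
Definition Smin (t : tree E) : ptree E :=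
  xget (repr t) [set s | pi s = t /\ forall s', pi s' = t -> ple s s'].

Lemma Smin_min t :
  pi (Smin t) = t /\ forall s, pi s = t -> ple (Smin t) s.
Proof.
apply: (@xgetPex _ (repr t) [set s | pi s = t /\ forall s', pi s' = t -> ple s s']).
exists (psort (repr t)); split=> [|s <-]; first by rewrite pi_psort /pi reprK.
by apply: iso_psort_ple; apply/piP; rewrite /pi reprK.
Qed.

Definition Sminl : {malg K[tree E]} -> {malg K[ptree E]} :=
  linext (fun t => << Smin t >>).

Definition PsiSmin (f : {malg K[tree E]}) : {malg K[tree E]} :=
  forget (Psi (Sminl f)).

(** * Leading terms *)

Implicit Types (I : set {malg K[tree E]}) (f g : {malg K[tree E]}).

Definition leading f (t : tree E) : Prop :=
  t \in msupp f /\ forall u, u \in msupp f -> tle u t.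

Definition TI I : set (tree E) :=
  [set t | exists f, [/\ I f, f != 0 & leading f t]].

Definition OI I : set (tree E) := ~` TI I.

Definition span_trees (A : set (tree E)) : set {malg K[tree E]} :=
  [set f | forall t, t \in msupp f -> A t].

(* [Can f I] is specified by the decomposition of the whole space as the direct
   sum of [I] and of the span of [OI I]; the default value 0 plays no role. *)
Definition Can f I : {malg K[tree E]} :=
  xget 0 [set g | span_trees (OI I) g /\ I (f - g)].

Definition preLie_rel : set {malg K[tree E]} := [set f | exists s t : tree E,
  f = (deg s)%:R *: graft << s >> << t >> + (deg t)%:R *: graft << t >> << s >>].

Definition preLie_ideal : set {malg K[tree E]} := ideal_gen (@graft K E) preLie_rel.

End Maps.
Arguments preLie_ideal : clear implicits.

(** * Monomial bases *)

(* [B] is a basis, as a set of vectors: its finite families of distinct elements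
   are linearly independent, and it spans [V]. *)
Definition is_basis (K : fieldType) (V : lmodType K) (B : set V) : Prop :=
  (forall (s : seq V) (c : V -> K), uniq s -> (forall x, x \in s -> B x) ->
     \sum_(x <- s) c x *: x = 0 -> forall x, x \in s -> c x = 0) /\
  (forall v, exists (s : seq V) (c : V -> K),
     (forall x, x \in s -> B x) /\ v = \sum_(x <- s) c x *: x).

Inductive is_monomial (K : fieldType) (d : nat -> nat) : freeLie K (gen d) -> Prop :=
| Mono_gen a : is_monomial (lgen K a)
| Mono_rhd x y : is_monomial x -> is_monomial y -> is_monomial (rhd x y).

Definition monomial_basis (K : fieldType) (d : nat -> nat)
    (B : set (freeLie K (gen d))) : Prop :=
  is_basis B /\ forall x, B x -> is_monomial x.

(* Main.v *)
Require Import Defs.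
From mathcomp Require Import all_boot all_order all_algebra.
From mathcomp Require Import boolp classical_sets.
From mathcomp Require Import finmap monalg.
From mathcomp Require Import ssrAC zify.

Set Implicit Arguments.
Unset Strict Implicit.
Unset Printing Implicit Defensive.

Import GRing.Theory.
Local Open Scope ring_scope.
Local Open Scope classical_set_scope.

(** The trees of O(I) are ladders, that is, trees in which no vertex has two
    branches. Ladders are fixed by the map Psi~ and sent by Phi to iterated
    products of generators, which gives both claims once O(I) is known to be a
    basis of the quotient by I, and Phi to identify this quotient with the free
    Lie algebra.

    Modulo I, the bracket [s, t] = |s| (s -> t) is antisymmetric by the very
    definition of I, and the pre-Lie identity ([preLie_identity]) then becomes
    the Jacobi identity ([ideal_jacobi]). So the linear map [beta] from
    bracketings of generators to trees that interprets the bracket in this way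
    sends the relations of a Lie algebra into I ([beta_ideal]). Every tree is a
    polynomial in the one-vertex trees for grafting ([graft_ind]); therefore
    [beta] is onto modulo I and inverts Phi modulo I ([beta_section]), and the
    kernel of Phi is exactly I ([Phi_ideal], [Phi_kernel]).

    By the Jacobi identity the free Lie algebra is spanned by the left-normed
    brackets of generators ([left_span_magma]), and [beta] sends these to
    multiples of ladders. So every tree is congruent modulo I to a combination
    of ladders of its own degree ([tree_ladder_comb]). The order compares the
    numbers of branches of the roots right after the degrees: a tree whose root
    has several branches is larger than those ladders, hence is the leading term
    of an element of I. A tree whose root has one branch is a leading term as
    soon as that branch is one, because grafting a combination of smaller trees
    on the root vertex gives a combination of smaller trees. Going up from the
    leaves, all trees of O(I) are ladders ([OI_ladder]).

    There are finitely many trees in each degree, so the order is well founded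
    and leading terms can be reduced until only trees of O(I) remain
    ([span_OI_decomposition]), while no nonzero element of I is a combination of
    trees of O(I) ([ideal_span_OI]). Hence Phi maps the span of O(I)
    isomorphically onto the free Lie algebra ([Phi_OI_basis]). *)

Local Notation pi := Defs.pi.
Local Notation mdeg := Defs.mdeg.

(** * Sums over graftings *)

Section GraftingSums.
Variables (E : countType) (V : zmodType).
Implicit Types (s t u : ptree E) (ts us vs : seq (ptree E)).
Implicit Types (phi : ptree E -> V) (psi : seq (ptree E) -> V).

Lemma all2_iso_refl ts : all2 (@iso E) ts ts.
Proof. by elim: ts => //= t ts ->; rewrite iso_refl. Qed.

Lemma iso_Node a ts us : all2 (@iso E) ts us -> iso (Node a ts) (Node a us).
Proof. by move=> h; apply/isoP; split=> //; exists us. Qed.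

Lemma perm_iso_Node a ts us : perm_eq ts us -> iso (Node a ts) (Node a us).
Proof.
by move=> h; apply/isoP; split=> //; exists ts => //; exact: all2_iso_refl.
Qed.

Lemma perm_swap (T : eqType) (x y : T) r : perm_eq (x :: y :: r) (y :: x :: r).
Proof. by apply/permP => p /=; rewrite addnCA. Qed.

Definition iso_invariant phi := forall s t, iso s t -> phi s = phi t.
Definition all2_invariant psi :=
  forall ts us, all2 (@iso E) ts us -> psi ts = psi us.
Definition perm_invariant psi := forall ts us, perm_eq ts us -> psi ts = psi us.

Lemma invariant_head psi ts :
  all2_invariant psi -> iso_invariant (fun u => psi (u :: ts)).
Proof. by move=> inv s t st; apply: inv; rewrite /= st all2_iso_refl. Qed.

Lemma invariant_tail psi t :
  all2_invariant psi -> all2_invariant (fun ts => psi (t :: ts)).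
Proof. by move=> inv ts us h; apply: inv; rewrite /= iso_refl. Qed.

Lemma invariant_Node phi a :
  iso_invariant phi -> all2_invariant (fun ts => phi (Node a ts)).
Proof. by move=> inv ts us h; apply/inv/iso_Node. Qed.

Lemma sum_graft_one_cons (f : ptree E -> seq (ptree E)) psi t ts :
  \sum_(us <- graft_one f (t :: ts)) psi us =
  \sum_(u <- f t) psi (u :: ts) + \sum_(us <- graft_one f ts) psi (t :: us).
Proof. by rewrite /= big_cat /= !big_map. Qed.

Lemma sum_grafts_Node s a ts phi :
  \sum_(u <- grafts s (Node a ts)) phi u =
  phi (Node a (s :: ts)) + \sum_(us <- graft_one (grafts s) ts) phi (Node a us).
Proof. by rewrite /= big_cons big_map. Qed.

(** When the order of a sequence is irrelevant, replacing one of its members in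
    place amounts to removing it and adding the new member in front. *)
Lemma sum_graft_one_rem (f : ptree E -> seq (ptree E)) psi ts :
  perm_invariant psi ->
  \sum_(us <- graft_one f ts) psi us =
  \sum_(t <- ts) \sum_(u <- f t) psi (u :: rem t ts).
Proof.
elim: ts psi => [|t ts IH] psi inv; first by rewrite !big_nil.
rewrite sum_graft_one_cons big_cons /= eqxx; congr (_ + _).
rewrite (IH (fun us => psi (t :: us))); last first.
  by move=> us vs p; apply: inv; rewrite perm_cons.
apply: eq_big_seq => t' t'ts; apply: eq_bigr => u _; apply: inv.
case: eqP => [e|_]; last exact: perm_swap.
rewrite (permPl (perm_swap _ _ _)) perm_cons e perm_sym.
exact: perm_to_rem.
Qed.

Lemma sum_graft_one_perm (f : ptree E -> seq (ptree E)) psi ts us :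
  perm_invariant psi -> perm_eq ts us ->
  \sum_(vs <- graft_one f ts) psi vs = \sum_(vs <- graft_one f us) psi vs.
Proof.
move=> inv p; rewrite !sum_graft_one_rem // (perm_big _ p) /=.
apply: eq_big_seq => t tus; apply: eq_bigr => u _; apply: inv; rewrite perm_cons.
have tts : t \in ts by rewrite (perm_mem p).
rewrite -(perm_cons t) -(permPl (perm_to_rem tts)) (permPl p).
exact: perm_to_rem.
Qed.

(** Grafting is well defined on non-planar trees: a function that does not see
    the planar embedding takes the same total on the graftings of two planar forms
    of the same trees. The list of branches may be permuted by
    [sum_graft_one_perm], and each branch replaced by an isomorphic one by
    induction. *)
Lemma sum_grafts_iso s s' t t' phi :
  iso_invariant phi -> iso s s' -> iso t t' ->
  \sum_(u <- grafts s t) phi u = \sum_(u <- grafts s' t') phi u.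
Proof.
move=> + ss'; elim/ptree_mem_ind: t t' phi => a ts IH [b ts'] phi inv.
case/isoP=> <- [us p h]; rewrite !sum_grafts_Node; congr (_ + _).
  apply: inv; apply/isoP; split=> //; exists (s' :: us); first by rewrite perm_cons.
  by rewrite /= ss'.
rewrite -(sum_graft_one_perm _ _ p); last by move=> vs vs' /perm_iso_Node/inv.
suff gen psi : all2_invariant psi ->
    \sum_(vs <- graft_one (grafts s) ts) psi vs =
    \sum_(vs <- graft_one (grafts s') us) psi vs.
  by apply: (gen (fun vs => phi (Node a vs))); exact: invariant_Node.
elim: ts us h IH psi {p inv} => [|t ts IHts] [|u us] //.
move=> /andP[tu h] IH psi inv.
rewrite !sum_graft_one_cons; congr (_ + _).
  rewrite (IH t (mem_head _ _) u _ (invariant_head _ inv) tu).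
  by apply: eq_bigr => v _; apply: inv; rewrite /= iso_refl.
rewrite (IHts us h _ _ (invariant_tail _ inv)).
  by apply: eq_bigr => vs _; apply: inv; rewrite /= tu all2_iso_refl.
by move=> v vts; apply: IH; rewrite in_cons vts orbT.
Qed.

(** [tree_assoc phi s t w] is the value of [phi] on the associator
    s -> (t -> w) - (s -> t) -> w, and [forest_assoc] its analogue for the
    derivation by which grafting acts on the sequence of branches. *)
Definition tree_assoc phi s t w :=
  \sum_(u <- grafts t w) \sum_(v <- grafts s u) phi v
  - \sum_(u <- grafts s t) \sum_(v <- grafts u w) phi v.

Definition forest_assoc psi s t ws :=
  \sum_(us <- graft_one (grafts t) ws) \sum_(vs <- graft_one (grafts s) us) psi vs
  - \sum_(u <- grafts s t) \sum_(vs <- graft_one (grafts u) ws) psi vs.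

(** If [t] is grafted on the root of [w], and then [s] on a vertex of [t], the
    term cancels with one of (s -> t) -> w. The other terms in which the root
    receives a tree are symmetric in [s] and [t], up to the order of the
    branches. *)
Lemma tree_assoc_Node phi s t a ws :
  tree_assoc phi s t (Node a ws) =
  phi (Node a (s :: t :: ws))
  + (\sum_(us <- graft_one (grafts s) ws) phi (Node a (t :: us))
     + \sum_(us <- graft_one (grafts t) ws) phi (Node a (s :: us)))
  + forest_assoc (fun us => phi (Node a us)) s t ws.
Proof.
rewrite /tree_assoc sum_grafts_Node; cbn beta.
rewrite sum_grafts_Node sum_graft_one_cons.
rewrite (eq_bigr _ (fun us _ => sum_grafts_Node s a us phi)).
rewrite (eq_bigr _ (fun u _ => sum_grafts_Node u a ws phi)).
rewrite !big_split /= /forest_assoc.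
rewrite opprD [LHS](AC ((1*2)*2*2) ((2*6)*(1*(3*4)*(5*7)))).
by rewrite /= subrr add0r.
Qed.

(** Grafting [s] and [t] on two different branches is symmetric; grafting both on
    the same branch is either the associator on the first branch or concerns the
    other ones only. *)
Lemma forest_assoc_cons psi s t w ws :
  forest_assoc psi s t (w :: ws) =
  tree_assoc (fun u => psi (u :: ws)) s t w
  + (\sum_(u <- grafts t w) \sum_(us <- graft_one (grafts s) ws) psi (u :: us)
     + \sum_(u <- grafts s w) \sum_(us <- graft_one (grafts t) ws) psi (u :: us))
  + forest_assoc (fun us => psi (w :: us)) s t ws.
Proof.
rewrite /forest_assoc sum_graft_one_cons; cbn beta.
rewrite (eq_bigr _ (fun u _ => sum_graft_one_cons (grafts s) psi u ws)).
rewrite (eq_bigr _ (fun us _ => sum_graft_one_cons (grafts s) psi w us)).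
rewrite (eq_bigr _ (fun u _ => sum_graft_one_cons (grafts u) psi w ws)).
rewrite !big_split /= /tree_assoc [X in _ + (X + _) - _]exchange_big /=.
by rewrite opprD [LHS](AC (2*2*2) ((1*5)*((2*3)*(4*6)))) /= !addrA.
Qed.

(** Grafting two trees [s] and [t] at vertices of [w] does not depend on the
    order in which they are grafted, up to the position of the new branches; the
    associator keeps exactly those terms. *)
Lemma tree_assoc_sym phi s t w :
  iso_invariant phi -> tree_assoc phi s t w = tree_assoc phi t s w.
Proof.
elim/ptree_mem_ind: w phi => a ws IH phi inv; rewrite !tree_assoc_Node.
congr (_ + _ + _); last 1 first.
- suff gen psi : all2_invariant psi ->
      forest_assoc psi s t ws = forest_assoc psi t s ws.
    by apply: (gen (fun vs => phi (Node a vs))); exact: invariant_Node.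
  elim: ws IH psi {inv} => [|w ws IHws] IH psi inv.
    by rewrite /forest_assoc /= !big_nil !big1 // => *; exact: big_nil.
  rewrite !forest_assoc_cons IH ?mem_head //; last exact: invariant_head.
  congr (_ + _ + _); first by rewrite addrC.
  apply: IHws; last exact: invariant_tail.
  by move=> v vts; apply: IH; rewrite in_cons vts orbT.
- by apply/inv/perm_iso_Node; exact: perm_swap.
- by rewrite addrC.
Qed.

End GraftingSums.

(** * Predicates stable under linear combinations *)

Section LinearInduction.
Variables (K : fieldType) (A B C : choiceType).

(** Stability is stated for arbitrary vectors, not only for multiples of basis
    elements, so that it can be checked once for all bilinear expressions. *)
Definition linear_stable (V : lmodType K) (P : V -> Prop) : Prop :=
  [/\ P 0, forall x y, P x -> P y -> P (x + y) & forall c x, P x -> P (c *: x)].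

Lemma msupp_stable (P : A -> Prop) :
  linear_stable (fun f : {malg K[A]} => forall a, a \in msupp f -> P a).
Proof.
split=> [a|f g hf hg a|c f hf a]; first by rewrite msupp0.
  move=> /(fsubsetP (msuppD_le _ _)); rewrite in_fsetU.
  by case/orP; [exact: hf|exact: hg].
by move=> /(fsubsetP (msuppZ_le _ _)); exact: hf.
Qed.

Lemma msuppU_all (P : A -> Prop) a :
  P a -> forall b, b \in msupp (<< a >> : {malg K[A]}) -> P b.
Proof. by move=> Pa b /(fsubsetP msuppU_le); rewrite in_fset1 => /eqP->. Qed.

Lemma msupp_ind (P : {malg K[A]} -> Prop) f :
  linear_stable P -> (forall a, a \in msupp f -> P << a >>) -> P f.
Proof.
move=> [P0 PD PZ] PU; rewrite (monalgE f) big_seq.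
by elim/big_ind: _ => // a af; rewrite malgUZ; apply/PZ/PU.
Qed.

Lemma msupp_ind2 (P : {malg K[A]} -> {malg K[B]} -> Prop) f g :
  (forall g, linear_stable (P^~ g)) -> (forall f, linear_stable (P f)) ->
  (forall a b, a \in msupp f -> b \in msupp g -> P << a >> << b >>) -> P f g.
Proof.
move=> Pl Pr PU; apply: (@msupp_ind (P^~ g)) => // a af.
rewrite (monalgE g) big_seq; case: (Pr << a >>) => P0 PD PZ.
by elim/big_ind: _ => // b bg; rewrite malgUZ; apply/PZ/PU.
Qed.

Lemma malg_ind3 (P : {malg K[A]} -> {malg K[B]} -> {malg K[C]} -> Prop) :
  (forall g h, linear_stable (fun f => P f g h)) ->
  (forall f h, linear_stable (fun g => P f g h)) ->
  (forall f g, linear_stable (P f g)) ->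
  (forall a b c, P << a >> << b >> << c >>) -> forall f g h, P f g h.
Proof.
move=> P1 P2 P3 PU f g h.
apply: (@msupp_ind2 (fun f g => P f g h)) => // a b _ _.
rewrite (monalgE h) big_seq; case: (P3 << a >> << b >>) => P0 PD PZ.
by elim/big_ind: _ => // c ch; rewrite malgUZ; apply: PZ.
Qed.

End LinearInduction.

(** An arbitrary bilinear product stands for grafting, for the product of
    bracketings and for their combinations: linearity arguments are the same for
    all of them. *)
Section Bilinear.
Variables (K : fieldType) (V : lmodType K) (m : V -> V -> V).
Hypothesis mDl : forall f g h, m (f + g) h = m f h + m g h.
Hypothesis mDr : forall f g h, m h (f + g) = m h f + m h g.
Hypothesis mZl : forall c f h, m (c *: f) h = c *: m f h.
Hypothesis mZr : forall c f h, m h (c *: f) = c *: m h f.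

Lemma bilinear0l h : m 0 h = 0.
Proof. by have := mZl 0 0 h; rewrite !scale0r. Qed.
Lemma bilinear0r h : m h 0 = 0.
Proof. by have := mZr 0 0 h; rewrite !scale0r. Qed.
Let m0l := bilinear0l.
Let m0r := bilinear0r.

Lemma associator_stable1 g h : linear_stable (fun f =>
  m f (m g h) - m (m f g) h = m g (m f h) - m (m g f) h).
Proof.
split=> [|x y IHx IHy|c x IH]; first by rewrite !(m0l, m0r).
    by rewrite !(mDl, mDr) !opprD addrACA IHx IHy addrACA.
  by rewrite !(mZl, mZr) -!scalerBr IH.
Qed.

Lemma associator_stable2 f h : linear_stable (fun g =>
  m f (m g h) - m (m f g) h = m g (m f h) - m (m g f) h).
Proof.
split=> [|x y IHx IHy|c x IH]; first by rewrite !(m0l, m0r).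
    by rewrite !(mDl, mDr) !opprD addrACA IHx IHy addrACA.
  by rewrite !(mZl, mZr) -!scalerBr IH.
Qed.

Lemma associator_stable3 f g : linear_stable (fun h =>
  m f (m g h) - m (m f g) h = m g (m f h) - m (m g f) h).
Proof.
split=> [|x y IHx IHy|c x IH]; first by rewrite !(m0l, m0r).
    by rewrite !(mDl, mDr) !opprD addrACA IHx IHy addrACA.
  by rewrite !(mZl, mZr) -!scalerBr IH.
Qed.

End Bilinear.

(** * Grafting of non-planar trees *)

Section Graft.
Variables (K : fieldType) (E : countType).
Local Notation T := {malg K[tree E]}.
Implicit Types (f g h : T) (s t w : tree E).

Lemma graftDl f g h : graft (f + g) h = graft f h + graft g h.
Proof. exact: bilextDl. Qed.
Lemma graftDr f g h : graft h (f + g) = graft h f + graft h g.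
Proof. exact: bilextDr. Qed.
Lemma graftZl c f h : graft (c *: f) h = c *: graft f h.
Proof. exact: bilextZl. Qed.
Lemma graftZr c f h : graft h (c *: f) = c *: graft h f.
Proof. exact: bilextZr. Qed.
Lemma graft0l h : graft 0 h = 0. Proof. exact: bilext0l. Qed.
Lemma graft0r h : graft h 0 = 0. Proof. exact: bilext0r. Qed.
Lemma graftBl f g h : graft (f - g) h = graft f h - graft g h.
Proof. by rewrite graftDl -scaleN1r graftZl scaleN1r. Qed.
Lemma graftBr f g h : graft h (f - g) = graft h f - graft h g.
Proof. by rewrite graftDr -scaleN1r graftZr scaleN1r. Qed.

Lemma graft_sumr (I : Type) (r : seq I) (F : I -> T) f :
  graft f (\sum_(i <- r) F i) = \sum_(i <- r) graft f (F i).
Proof.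
by elim/big_rec2: _ => [|i x y _ <-]; rewrite ?graft0r // graftDr.
Qed.

Lemma graft_suml (I : Type) (r : seq I) (F : I -> T) f :
  graft (\sum_(i <- r) F i) f = \sum_(i <- r) graft (F i) f.
Proof.
by elim/big_rec2: _ => [|i x y _ <-]; rewrite ?graft0l // graftDl.
Qed.

Lemma pi_isoP (p q : ptree E) : reflect (pi p = pi q) (iso p q).
Proof. exact: eqmodP. Qed.

Lemma iso_repr (p : ptree E) : iso (repr (pi p)) p.
Proof. by apply/pi_isoP; rewrite /pi reprK. Qed.

Lemma iso_invariant_pi (V : zmodType) (phi : tree E -> V) :
  iso_invariant (fun p => phi (pi p)).
Proof. by move=> p q pq; congr phi; exact/pi_isoP. Qed.

Lemma graftU (p q : ptree E) :
  graft << pi p >> << pi q >> = \sum_(u <- grafts p q) << pi u >> :> T.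
Proof.
rewrite /graft bilextU.
have inv := iso_invariant_pi (fun t => << t >> : T).
exact: (sum_grafts_iso inv (iso_repr p) (iso_repr q)).
Qed.

Lemma graftUU s t :
  graft << s >> << t >> =
  \sum_(u <- grafts (repr s) (repr t)) << pi u >> :> T.
Proof. by rewrite -graftU /pi !reprK. Qed.

Lemma preLie_identity f g h :
  graft f (graft g h) - graft (graft f g) h =
  graft g (graft f h) - graft (graft g f) h.
Proof.
move: f g h; apply: malg_ind3 => [g h|f h|f g|s t w].
- exact: (associator_stable1 graftDl graftDr graftZl graftZr).
- exact: (associator_stable2 graftDl graftDr graftZl graftZr).
- exact: (associator_stable3 graftDr graftZr).
have assocE (x y : tree E) :
    graft << x >> (graft << y >> << w >>) - graft (graft << x >> << y >>) << w >> =
    tree_assoc (fun u => << pi u >> : T) (repr x) (repr y) (repr w).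
  rewrite [X in graft _ X - _]graftUU [X in _ - graft X _]graftUU.
  rewrite graft_sumr graft_suml /tree_assoc.
  by congr (_ - _); apply: eq_bigr => u _; rewrite -graftU /pi reprK.
apply: (etrans (assocE s t)); apply: (etrans _ (esym (assocE t s))).
exact/tree_assoc_sym/(iso_invariant_pi (fun t => << t >> : T)).
Qed.

End Graft.

Section Degrees.
Variable d : nat -> nat.
Local Notation E := (gen d).
Implicit Types (p q : ptree E).

Lemma pdeg_gt0 p : (0 < pdeg p)%N. Proof. by case: p. Qed.

Lemma pdeg_iso p q : iso p q -> pdeg p = pdeg q.
Proof. by move/iso_psort_eq => e; rewrite -(pdeg_psort p) e pdeg_psort. Qed.

Lemma deg_pi p : deg (pi p) = pdeg p.
Proof. exact/pdeg_iso/iso_repr. Qed.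

Lemma graft_one_degree (f : ptree E -> seq (ptree E)) n ts us :
  (forall t, t \in ts -> forall u, u \in f t -> pdeg u = n + pdeg t)%N ->
  us \in graft_one f ts ->
  size us = size ts /\ sumn (map (@pdeg d) us) = (n + sumn (map (@pdeg d) ts))%N.
Proof.
elim: ts us => [|t ts IH] us //= H; rewrite mem_cat.
case/orP=> /mapP[u hu ->] /=; first by rewrite (H t (mem_head _ _) u hu) addnA.
have [|-> ->] := IH u _ hu; last by rewrite addnCA.
by move=> x xts; apply: H; rewrite in_cons xts orbT.
Qed.

Lemma pdeg_grafts p q u : u \in grafts p q -> pdeg u = (pdeg p + pdeg q)%N.
Proof.
elim/ptree_mem_ind: q u => a ts IH u /=.
rewrite in_cons => /orP[/eqP->|/mapP[us hus ->]] /=; first by rewrite addnCA.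
by have [_ ->] := graft_one_degree IH hus; rewrite addnCA.
Qed.

(** Every tree is a polynomial, for the grafting product, in the one-vertex
    trees: B_a(t_1, ..., t_k) is t_1 -> B_a(t_2, ..., t_k) up to trees of the
    same degree whose root has k-1 branches. *)
Lemma graft_ind (K : fieldType) (Q : nat -> {malg K[tree E]} -> Prop) :
  (forall n, Q n 0) ->
  (forall n f g, Q n f -> Q n g -> Q n (f + g)) ->
  (forall n c f, Q n f -> Q n (c *: f)) ->
  (forall a, Q (gdeg a) << vertex a >>) ->
  (forall m n f g, Q m f -> Q n g -> Q (m + n)%N (graft f g)) ->
  forall t, Q (deg t) << t >>.
Proof.
move=> Q0 QD QZ Qv Qg t; rewrite -(reprK t) -/(pi _) deg_pi.
move: (repr t) => {t} p; have [n] := ubnP (pdeg p); elim: n p => // n IHn p.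
have [k] := ubnP (size (pbranches p)); elim: k p => // k IHk [a [|s ts]].
  by move=> _ _; rewrite /= addn0; exact: Qv.
rewrite ltnS /= => size_ts deg_ts.
have a_gt0 : (0 < gdeg a)%N by [].
have s_gt0 := pdeg_gt0 s.
have Qs : Q (pdeg s) << pi s >> by apply: IHn; lia.
have Qts : Q (pdeg (Node a ts)) << pi (Node a ts) >> by apply: IHn => /=; lia.
have := Qg _ _ _ _ Qs Qts; rewrite graftU /= big_cons big_map addnCA => Qst.
set r := \sum_(us <- _) _ in Qst; rewrite -[<< _ >>](addrK r).
apply: (QD _ _ _ Qst); rewrite -scaleN1r; apply: QZ; rewrite /r big_seq.
elim/big_ind: _ => [|f g|us hus]; [exact: Q0|exact: QD|].
have [sz dg] := graft_one_degree (fun t _ => @pdeg_grafts s t) hus.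
have <- : pdeg (Node a us) = (gdeg a + (pdeg s + sumn (map (@pdeg d) ts)))%N.
  by rewrite /= dg.
by apply: IHk; rewrite /= ?sz ?dg.
Qed.

End Degrees.

(** * The quotient by the ideal is a Lie algebra *)

Section BilinearClosure.
Variables (K : fieldType) (V W : lmodType K) (m : V -> V -> V).
Hypothesis mDl : forall f g h, m (f + g) h = m f h + m g h.
Hypothesis mDr : forall f g h, m h (f + g) = m h f + m h g.
Hypothesis mZl : forall c f h, m (c *: f) h = c *: m f h.
Hypothesis mZr : forall c f h, m h (c *: f) = c *: m h f.
Let m0l := bilinear0l mZl.
Let m0r := bilinear0r mZr.

Lemma linear_stable_preim (J : W -> Prop) (F : V -> W) :
  (forall x y, F (x + y) = F x + F y) -> (forall c x, F (c *: x) = c *: F x) ->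
  linear_stable J -> linear_stable (fun x => J (F x)).
Proof.
move=> FD FZ [J0 JD JZ]; split=> [|x y|c x]; rewrite ?FD ?FZ.
- by have := FZ 0 0; rewrite !scale0r => ->.
- exact: JD.
- exact: JZ.
Qed.

Section Predicate.
Variable J : V -> Prop.
Hypothesis Jlin : linear_stable J.

Lemma product_stablel g : linear_stable (fun f => J (m f g)).
Proof.
case: Jlin => J0 JD JZ; split=> [|x y Jx Jy|c x Jx].
- by rewrite m0l.
- by rewrite mDl; exact: JD.
- by rewrite mZl; exact: JZ.
Qed.

Lemma product_stabler f : linear_stable (fun g => J (m f g)).
Proof.
case: Jlin => J0 JD JZ; split=> [|x y Jx Jy|c x Jx].
- by rewrite m0r.
- by rewrite mDr; exact: JD.
- by rewrite mZr; exact: JZ.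
Qed.

Lemma anti_stablel a b g : linear_stable (fun f => J (a *: m f g + b *: m g f)).
Proof.
case: Jlin => J0 JD JZ; split=> [|x y Jx Jy|c x Jx].
- by rewrite m0l m0r !scaler0 addr0.
- by rewrite mDl mDr !scalerDr addrACA; exact: JD.
- by rewrite mZl mZr !scalerA ![_ * c]mulrC -!scalerA -scalerDr; exact: JZ.
Qed.

Lemma anti_stabler a b f : linear_stable (fun g => J (a *: m f g + b *: m g f)).
Proof.
case: (anti_stablel b a f) => J0 JD JZ.
split=> [|x y|c x]; first by rewrite addrC.
  by rewrite ![a *: m f _ + _]addrC; exact: JD.
by rewrite ![a *: m f _ + _]addrC; exact: JZ.
Qed.

End Predicate.

(** The identity F (x . y) = a (F x . F y) is checked on a basis; the rescaling
    [G] allows for products, such as the pre-Lie product of the free Lie algebra,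
    that first divide [x] by its degree. *)
Section Morphism.
Variables (m' : W -> W -> W) (F : V -> W) (G : V -> V) (a : K).
Hypothesis mDl' : forall f g h, m' (f + g) h = m' f h + m' g h.
Hypothesis mDr' : forall f g h, m' h (f + g) = m' h f + m' h g.
Hypothesis mZl' : forall c f h, m' (c *: f) h = c *: m' f h.
Hypothesis mZr' : forall c f h, m' h (c *: f) = c *: m' h f.
Hypothesis FD : forall x y, F (x + y) = F x + F y.
Hypothesis FZ : forall c x, F (c *: x) = c *: F x.
Hypothesis GD : forall x y, G (x + y) = G x + G y.
Hypothesis GZ : forall c x, G (c *: x) = c *: G x.

Lemma morphism_stablel y :
  linear_stable (fun x => F (m (G x) y) = a *: m' (F x) (F y)).
Proof.
split=> [|x x' IH IH'|c x IH].
- have [F0 G0] : F 0 = 0 /\ G 0 = 0.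
    by split; [have := FZ 0 0|have := GZ 0 0]; rewrite !scale0r.
  by rewrite G0 m0l F0 (bilinear0l mZl') scaler0.
- by rewrite GD mDl !FD mDl' IH IH' scalerDr.
- by rewrite GZ mZl !FZ mZl' IH !scalerA mulrC.
Qed.

Lemma morphism_stabler x :
  linear_stable (fun y => F (m (G x) y) = a *: m' (F x) (F y)).
Proof.
split=> [|y y' IH IH'|c y IH].
- have F0 : F 0 = 0 by have := FZ 0 0; rewrite !scale0r.
  by rewrite m0r F0 (bilinear0r mZr') scaler0.
- by rewrite mDr !FD mDr' IH IH' scalerDr.
- by rewrite mZr !FZ mZr' IH !scalerA mulrC.
Qed.

End Morphism.

(** When [m] stands for grafting and [a], [b], [c] for the degrees of [f], [g],
    [h], the left-hand side is the Jacobi sum of the bracket [f, g] = a (f . g),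
    and the three terms on the right are consequences of its antisymmetry. *)
Lemma preLie_jacobi a b c f g h :
  m f (m g h) - m (m f g) h = m g (m f h) - m (m g f) h ->
  a *: m f (b *: m g h) + b *: m g (c *: m h f) + c *: m h (a *: m f g) =
  (c *: m h (a *: m f g) + (a + b) *: m (a *: m f g) h)
  + b *: m g (c *: m h f + a *: m f h)
  - a *: m (b *: m g f + a *: m f g) h.
Proof.
move=> e; have -> : m f (b *: m g h) =
    b *: (m (m f g) h + (m g (m f h) - m (m g f) h)).
  by rewrite mZr -e addrC subrK.
rewrite !(mZl, mZr, mDl, mDr) !(scalerDr, scalerDl, scalerN, scalerA, opprD, mulrDl).
rewrite (mulrC b a) [RHS](AC ((1*2)*2*2) ((2*7)*((3*(5*6))*4*1))) /=.
by rewrite subrr add0r.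
Qed.

End BilinearClosure.

Section PreLieIdeal.
Variables (K : fieldType) (d : nat -> nat).
Hypothesis charK : [pchar K] =i pred0.
Local Notation E := (gen d).
Local Notation T := {malg K[tree E]}.
Local Notation M := {malg K[magma E]}.
Local Notation L := (freeLie K E).
Local Notation I := (preLie_ideal K d).
Local Notation mmul := (@Defs.mmul K E).
Local Notation hom := (@Defs.hom K d).
Implicit Types (f g h : T) (x y z : M) (m n : nat).

Let gDl := @graftDl K E.
Let gDr := @graftDr K E.
Let gZl := @graftZl K E.
Let gZr := @graftZr K E.
Let mDl := @mmulDl K E.
Let mDr := @mmulDr K E.
Let mZl := @mmulZl K E.
Let mZr := @mmulZr K E.

Lemma ideal0 : I 0. Proof. exact: Ideal_0. Qed.
Lemma idealD f g : I f -> I g -> I (f + g). Proof. exact: Ideal_D. Qed.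
Lemma idealZ c f : I f -> I (c *: f). Proof. exact: Ideal_Z. Qed.
Lemma ideal_stable : linear_stable (I : T -> Prop).
Proof. by split=> *; [exact: ideal0|exact: idealD|exact: idealZ]. Qed.
Lemma idealN f : I f -> I (- f).
Proof. by rewrite -scaleN1r; exact: idealZ. Qed.
Lemma idealB f g : I f -> I g -> I (f - g).
Proof. by move=> If Ig; apply/idealD/idealN. Qed.
Lemma ideal_graftl f g : I g -> I (graft f g). Proof. exact: Ideal_l. Qed.
Lemma ideal_graftr f g : I f -> I (graft f g). Proof. exact: Ideal_r. Qed.

Lemma ideal_trans f g h : I (f - g) -> I (g - h) -> I (f - h).
Proof. by move=> fg gh; rewrite -(subrK g f) -addrA; exact: idealD. Qed.

Lemma ideal_sym f g : I (f - g) -> I (g - f).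
Proof. by move=> fg; rewrite -opprB; exact: idealN. Qed.

Definition homogeneous n f := forall t, t \in msupp f -> deg t = n.

Lemma homogeneous_stable n : linear_stable (homogeneous n).
Proof. exact: msupp_stable. Qed.

Lemma homogeneousZ n c f : homogeneous n f -> homogeneous n (c *: f).
Proof. by case: (homogeneous_stable n) => _ _; apply. Qed.

Lemma homogeneousU t : homogeneous (deg t) << t >>.
Proof. exact: msuppU_all. Qed.

Lemma homogeneous_graft m n f g :
  homogeneous m f -> homogeneous n g -> homogeneous (m + n) (graft f g).
Proof.
have st := homogeneous_stable (m + n).
move=> hf hg; apply: (@msupp_ind2 _ _ _ (fun f g => homogeneous (m + n) (graft f g))).
- exact: (product_stablel gDl gZl st).
- exact: (product_stabler gDr gZr st).
move=> s t /hf <- /hg <-; rewrite graftUU big_seq.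
case: (homogeneous_stable (deg s + deg t)) => h0 hD _.
elim/big_ind: _ => [|x y|u /pdeg_grafts e]; [exact: h0|exact: hD|].
by rewrite /deg -e -deg_pi; exact: homogeneousU.
Qed.

(** The generators of the ideal, extended bilinearly. *)
Lemma ideal_anti m n f g : homogeneous m f -> homogeneous n g ->
  I (m%:R *: graft f g + n%:R *: graft g f).
Proof.
have st := ideal_stable.
move=> hf hg; apply: (@msupp_ind2 _ _ _ (fun f g =>
  I (m%:R *: graft f g + n%:R *: graft g f))).
- move=> x; exact: (anti_stablel gDl gDr gZl gZr st).
- move=> x; exact: (anti_stabler gDl gDr gZl gZr st).
by move=> s t /hf <- /hg <-; apply: Ideal_gen; exists s, t.
Qed.

Lemma natr_neq0 n : (0 < n)%N -> n%:R != 0 :> K.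
Proof. by move=> n0; have /pcharf0P -> := charK; rewrite -lt0n. Qed.

Lemma ideal_jacobi m n p f g h :
  homogeneous m f -> homogeneous n g -> homogeneous p h ->
  I (m%:R *: graft f (n%:R *: graft g h) +
     n%:R *: graft g (p%:R *: graft h f) +
     p%:R *: graft h (m%:R *: graft f g)).
Proof.
move=> hf hg hh.
rewrite (preLie_jacobi gDl gDr gZl gZr _ _ _ (preLie_identity f g h)).
apply: idealB; first apply: idealD.
- rewrite -natrD; apply: ideal_anti => //.
  by apply: homogeneousZ; exact: homogeneous_graft.
- by apply/idealZ/ideal_graftl/ideal_anti.
by apply/idealZ/ideal_graftr/ideal_anti.
Qed.

(** Bracketings are interpreted in trees by [s, t] = |s| (s -> t), which is how
    the bracket of the free Lie algebra is recovered from its pre-Lie product. *)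
Fixpoint beta_magma (s : magma E) : T :=
  match s with
  | Gen a => << vertex a >>
  | Br l r => (mdeg l)%:R *: graft (beta_magma l) (beta_magma r)
  end.

Definition beta : M -> T := linext beta_magma.

Lemma betaD x y : beta (x + y) = beta x + beta y. Proof. exact: linearD. Qed.
Lemma betaZ c x : beta (c *: x) = c *: beta x. Proof. exact: linearZ. Qed.
Lemma beta0 : beta 0 = 0. Proof. exact: linear0. Qed.
Lemma betaB x y : beta (x - y) = beta x - beta y. Proof. exact: linearB. Qed.
Lemma betaU s : beta << s >> = beta_magma s. Proof. exact: linextU. Qed.

Lemma beta_homogeneous n x : hom n x -> homogeneous n (beta x).
Proof.
move=> hx; apply: (@msupp_ind _ _ (fun x => homogeneous n (beta x))).
  exact: (linear_stable_preim betaD betaZ (homogeneous_stable n)).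
move=> s /hx <-; rewrite betaU.
elim: s => [a|l hl r hr] /=; last by apply: homogeneousZ; exact: homogeneous_graft.
rewrite (_ : gdeg a = deg (vertex a)); first exact: homogeneousU.
by rewrite deg_pi /= addn0.
Qed.

Lemma beta_mmul n x y :
  hom n x -> beta (mmul x y) = n%:R *: graft (beta x) (beta y).
Proof.
move=> hx; apply: (@msupp_ind2 _ _ _ (fun x y =>
  beta (mmul x y) = n%:R *: graft (beta x) (beta y))).
- move=> z.
  exact: (@morphism_stablel _ _ _ mmul mDl mZl _ beta id _ gDl gZl betaD betaZ
    (fun _ _ => erefl) (fun _ _ => erefl)).
- move=> z.
  exact: (@morphism_stabler _ _ _ mmul mDr mZr _ beta id _ gDr gZr betaD betaZ).
move=> s t /hx <- _; apply: (etrans (congr1 beta (mmulUU _ s t))).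
apply: (etrans (betaU (Br s t))).
exact: (esym (congr2 (fun f g => (mdeg s)%:R *: graft f g) (betaU s) (betaU t))).
Qed.

Lemma beta_anti x y : I (beta (mmul x y + mmul y x)).
Proof.
have st := linear_stable_preim betaD betaZ ideal_stable.
rewrite -[mmul x y]scale1r -[mmul y x]scale1r.
apply: (@msupp_ind2 _ _ _ (fun x y => I (beta (1 *: mmul x y + 1 *: mmul y x)))).
- move=> z; exact: (anti_stablel mDl mDr mZl mZr st).
- move=> z; exact: (anti_stabler mDl mDr mZl mZr st).
have anti_hom m n u v : hom m u -> hom n v -> I (beta (1 *: mmul u v + 1 *: mmul v u)).
  move=> hu hv; rewrite !scale1r betaD (beta_mmul _ hu) (beta_mmul _ hv).
  by apply: ideal_anti; exact: beta_homogeneous.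
by move=> s t _ _; apply: anti_hom; exact: Defs.homU.
Qed.

Lemma ideal_half f : I (f + f) -> I f.
Proof.
have n2 := natr_neq0 (isT : 0 < 2)%N.
by move/(idealZ 2%:R^-1); rewrite -mulr2n -scaler_nat scalerA mulVf // scale1r.
Qed.

Lemma jac_stable (J : M -> Prop) y z :
  linear_stable J -> linear_stable (fun x => J (jac x y z)).
Proof.
move=> [J0 JD JZ]; split=> [|x x' Jx Jx'|c x Jx].
- by rewrite jac0l.
- by rewrite jacDl; exact: JD.
- by rewrite jacZl; exact: JZ.
Qed.

Lemma beta_jac x y z : I (beta (jac x y z)).
Proof.
have st := linear_stable_preim betaD betaZ ideal_stable.
move: x y z; apply: malg_ind3 => [y z|x z|x y|s t r].
- exact: (jac_stable _ _ st).
- case: (jac_stable z x st) => J0 JD JZ.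
  by split=> [|y y'|c y]; rewrite !(jac_rot x); [exact: J0|exact: JD|exact: JZ].
- case: (jac_stable x y st) => J0 JD JZ.
  by split=> [|z z'|c z]; rewrite -!(jac_rot _ x y); [exact: J0|exact: JD|exact: JZ].
have jac_hom m n p u v w : hom m u -> hom n v -> hom p w -> I (beta (jac u v w)).
  move=> hu hv hw; rewrite /jac !betaD !(beta_mmul _ hu) !(beta_mmul _ hv).
  rewrite !(beta_mmul _ hw) (beta_mmul _ hu).
  by apply: ideal_jacobi; exact: beta_homogeneous.
by apply: jac_hom; exact: Defs.homU.
Qed.

(** The trees satisfy the axioms of a Lie algebra modulo the ideal. In the image of
    a product x . y, the components of [x] are weighted by their degrees; when it
    is [x] that is sent into the ideal, antisymmetry moves it to the right, where
    it is not weighted. *)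
Lemma beta_ideal (x : M) : ideal_gen mmul (@lie_rel K E) x -> I (beta x).
Proof.
have st := linear_stable_preim betaD betaZ ideal_stable.
have ideal_l u v : I (beta v) -> I (beta (mmul u v)).
  move=> Iv; apply: (@msupp_ind _ _ (fun u => I (beta (mmul u v)))).
    exact: (product_stablel mDl mZl st).
  move=> s _; rewrite (beta_mmul _ (@Defs.homU K d s)).
  by apply: idealZ; exact: ideal_graftl.
elim=> {x} [x [[y ->]|[y [z [t ->]]]]||x y _ Ix _ Iy|c x _ Ix|x y _ Iy|x y _ Ix].
- by apply: ideal_half; rewrite -betaD; exact: beta_anti.
- exact: beta_jac.
- by rewrite beta0; exact: ideal0.
- by rewrite betaD; exact: idealD.
- by rewrite betaZ; exact: idealZ.
- exact: ideal_l.
rewrite -[mmul x y](addrK (mmul y x)) betaB.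
by apply: idealB; [exact: beta_anti|exact: ideal_l].
Qed.

Lemma mdeg_gt0 (s : magma E) : (0 < mdeg s)%N.
Proof. by elim: s => //= l hl r hr; rewrite addn_gt0 hl. Qed.

Lemma beta_rhd (x y : M) :
  beta (mmul (invdeg x) y) = graft (beta x) (beta y).
Proof.
rewrite -[RHS]scale1r.
apply: (@msupp_ind _ _ (fun x =>
    beta (mmul (invdeg x) y) = 1 *: graft (beta x) (beta y))).
  apply: (morphism_stablel mDl mZl 1 gDl gZl betaD betaZ).
    by move=> u v; rewrite /invdeg linearD.
  by move=> c u; rewrite /invdeg linearZ.
move=> s _; rewrite /invdeg linextU mmulZl betaZ (beta_mmul _ (@Defs.homU K d s)) scalerA.
by rewrite mulVf // natr_neq0 // mdeg_gt0.
Qed.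

Definition preLie_morphism (Phi : T -> L) : Prop :=
  (forall f g, Phi (graft f g) = rhd (Phi f) (Phi g)) /\
  (forall a : gen d, Phi << vertex a >> = lgen K a).

(** [beta] intertwines the pre-Lie product of bracketings with grafting
    ([beta_rhd]); as the one-vertex trees generate all trees, every tree is
    reached modulo the ideal, by a bracketing that lifts its image under any
    pre-Lie morphism. *)
Lemma beta_section t : exists x : M,
  [/\ hom (deg t) x, I (beta x - << t >>) &
      forall Phi : {linear T -> L}, preLie_morphism Phi -> lpi x = Phi << t >>].
Proof.
move: t; apply: (@graft_ind _ _ (fun n f => exists x : M,
  [/\ hom n x, I (beta x - f) &
      forall Phi : {linear T -> L}, preLie_morphism Phi -> lpi x = Phi f])).
- move=> n; exists 0; split; first exact: hom0.
    by rewrite beta0 subrr; exact: ideal0.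
  by move=> Phi _; rewrite lpi0 linear0.
- move=> n f g [x [hx Ix Px]] [y [hy Iy Py]]; exists (x + y); split.
  + exact: homD.
  + by rewrite betaD opprD addrACA; exact: idealD.
  by move=> Phi P; rewrite lpiD linearD (Px _ P) (Py _ P).
- move=> n c f [x [hx Ix Px]]; exists (c *: x); split.
  + exact: homZ.
  + by rewrite betaZ -scalerBr; exact: idealZ.
  by move=> Phi P; rewrite lpiZ linearZ (Px _ P).
- move=> a; exists << Gen a >>; split; first exact: (@Defs.homU K d (Gen a)).
    by rewrite betaU subrr; exact: ideal0.
  by move=> Phi [_ ->].
move=> m n f g [x [hx Ix Px]] [y [hy Iy Py]]; exists (mmul (invdeg x) y); split.
- by apply: homM hy; rewrite (invdeg_hom hx); exact: homZ.
- rewrite beta_rhd; apply: (@ideal_trans _ (graft f (beta y))).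
    by rewrite -graftBl; exact: ideal_graftr.
  by rewrite -graftBr; exact: ideal_graftl.
move=> Phi P; rewrite -rhd_pi (Px _ P) (Py _ P).
by case: P => ->.
Qed.

End PreLieIdeal.

(** * Left-normed brackets and ladders *)

Section LeftNormed.
Variables (K : fieldType) (d : nat -> nat).
Local Notation E := (gen d).
Local Notation M := {malg K[magma E]}.
Local Notation L := (freeLie K E).
Local Notation mmul := (@Defs.mmul K E).
Implicit Types (x y z : L) (s : magma E) (n : nat).

Lemma lbrDl x y z : lbr (x + y) z = lbr x z + lbr y z.
Proof. by rewrite -[x]scale1r lbr_linearl !scale1r. Qed.
Lemma lbrDr x y z : lbr z (x + y) = lbr z x + lbr z y.
Proof. by rewrite -[x]scale1r lbr_linearr !scale1r. Qed.
Lemma lbr0r z : lbr z 0 = 0.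
Proof. by apply: (@addrI _ (lbr z 0)); rewrite -lbrDr !addr0. Qed.
Lemma lbrNr x z : lbr z (- x) = - lbr z x.
Proof. by apply: (@addrI _ (lbr z x)); rewrite -lbrDr !subrr lbr0r. Qed.

Lemma lbrC x y : lbr x y = - lbr y x.
Proof.
apply/eqP; rewrite -addr_eq0; apply/eqP; have := lbrxx (x + y).
by rewrite lbrDl !lbrDr !lbrxx add0r addr0.
Qed.

Lemma lbr_leibniz x y z : lbr x (lbr y z) = lbr (lbr x y) z - lbr (lbr x z) y.
Proof.
have := lbr_jacobi x y z.
rewrite (lbrC z x) lbrNr (lbrC y (lbr x z)) opprK (lbrC z (lbr x y)) => J.
by apply/eqP; rewrite -subr_eq0 -[X in _ == X]J opprB addrA.
Qed.

Fixpoint left_normed s : bool :=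
  match s with
  | Gen _ => true
  | Br l r => left_normed l && (if r is Gen _ then true else false)
  end.

Definition left_span n x : Prop := exists2 m : M,
  (forall s, s \in msupp m -> left_normed s /\ mdeg s = n) & lpi m = x.

Lemma left_span_stable n : linear_stable (left_span n).
Proof.
have [h0 hD hZ] := @msupp_stable K _ (fun s => left_normed s /\ mdeg s = n).
split=> [|x y [m hm <-] [m' hm' <-]|c x [m hm <-]].
- by exists 0; [exact: h0|exact: lpi0].
- by exists (m + m'); [exact: hD|exact: lpiD].
- by exists (c *: m); [exact: hZ|exact: lpiZ].
Qed.

Lemma left_spanU s : left_normed s -> left_span (mdeg s) (lpi << s >>).
Proof.
by move=> hs; exists << s >> => //; exact: msuppU_all.
Qed.

(** By the Jacobi identity, bracketing with [y, z] is bracketing with [y] and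
    then with [z], minus the same in the other order; so only brackets with
    generators on the right remain. *)
Lemma left_span_lbr s n x :
  left_span n x -> left_span (n + mdeg s) (lbr x (lpi << s >>)).
Proof.
elim: s n x => [a|l IHl r IHr] n x.
  move=> [m hm <-]; rewrite lbr_pi.
  have st := linear_stable_preim (@lpiD K E) (@lpiZ K E) (left_span_stable (n + gdeg a)).
  apply: (@msupp_ind _ _ (fun m => left_span (n + gdeg a) (lpi (mmul m << Gen a >>)))).
    exact: (product_stablel (@mmulDl K E) (@mmulZl K E) st).
  move=> s /hm[hs <-]; rewrite mmulUU.
  by apply: (@left_spanU (Br s (Gen a))); rewrite /= hs.
move=> hx; rewrite -mmulUU -lbr_pi lbr_leibniz -scaleN1r /=.
case: (left_span_stable (n + (mdeg l + mdeg r))) => _ SD SZ.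
apply: SD; first by rewrite addnA; apply/IHr/IHl.
by apply: SZ; rewrite [(mdeg l + _)%N]addnC addnA; apply/IHl/IHr.
Qed.

Lemma left_span_magma s : left_span (mdeg s) (lpi << s >>).
Proof.
elim: s => [a|l IHl r _]; first exact: (@left_spanU (Gen a)).
by rewrite -mmulUU -lbr_pi; exact: left_span_lbr.
Qed.

Lemma left_span_hom n (m : M) : Defs.hom n m -> left_span n (lpi m).
Proof.
move=> hm; apply: (@msupp_ind _ _ (fun m => left_span n (lpi m))).
  exact: (linear_stable_preim (@lpiD K E) (@lpiZ K E) (left_span_stable n)).
by move=> s /hm <-; exact: left_span_magma.
Qed.

End LeftNormed.

Section Ladders.
Variables (K : fieldType) (d : nat -> nat).
Hypothesis charK : [pchar K] =i pred0.
Local Notation E := (gen d).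
Local Notation T := {malg K[tree E]}.
Local Notation M := {malg K[magma E]}.
Local Notation I := (preLie_ideal K d).

Fixpoint ladder (p : ptree E) : bool :=
  match pbranches p with [::] => true | [:: q] => ladder q | _ => false end.

Lemma graft_vertex (p : ptree E) a :
  graft << pi p >> << vertex a >> = << pi (Node a [:: p]) >> :> T.
Proof. by rewrite graftU big_seq1. Qed.

Lemma beta_left_normed s : left_normed s -> exists c p,
  [/\ ladder p, pdeg p = mdeg s & beta_magma K s = c *: << pi p >>].
Proof.
elim: s => [a _|l IHl [a|r1 r2] _]; last by rewrite /= andbF.
  by exists 1, (Node a [::]); rewrite /= addn0 scale1r.
rewrite /= andbT => /IHl[c [p [lp dp ->]]].
exists ((mdeg l)%:R * c), (Node a [:: p]).
split; [exact: lp|by rewrite /= addn0 addnC dp|].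
by rewrite graftZl graft_vertex scalerA.
Qed.

Definition ladder_comb n (f : T) : Prop :=
  forall t, t \in msupp f -> exists2 p, ladder p & t = pi p /\ pdeg p = n.

(** The ladders of a given degree span the component of this degree of the
    quotient by the ideal, since they correspond to the left-normed brackets. *)
Lemma tree_ladder_comb t : exists2 f, ladder_comb (deg t) f & I (<< t >> - f).
Proof.
have [x [hx Ix _]] := beta_section charK t.
have [y hy exy] := left_span_hom hx.
have Iyx : I (beta y - beta x).
  by rewrite -betaB; apply: (beta_ideal charK); exact/lie_idealP/lpiP.
have : exists2 f, ladder_comb (deg t) f & I (beta y - f).
  exists (beta y); last by rewrite subrr; exact: ideal0.
  apply: (@msupp_ind _ _ (fun y => ladder_comb (deg t) (beta y))).
    apply: (linear_stable_preim (@betaD K d) (@betaZ K d)).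
    exact: msupp_stable.
  move=> s /hy[/beta_left_normed[c [p [lp dp e]]] ds].
  rewrite betaU e => u /(fsubsetP (msuppZ_le _ _))/(fsubsetP msuppU_le).
  by rewrite in_fset1 => /eqP->; exists p; rewrite // dp.
case=> f hf If; exists f => //.
apply: ideal_trans If; apply: ideal_trans (ideal_sym Iyx).
exact: ideal_sym.
Qed.

End Ladders.

(** * Leading terms *)

Section Order.
Variable d : nat -> nat.
Local Notation E := (gen d).
Implicit Types (p q : ptree E) (s t u : tree E).

Lemma tlt_pi p q : tlt (pi p) (pi q) = plt (psort p) (psort q).
Proof. by rewrite /tlt !psort_repr_pi. Qed.

Lemma tlt_irr t : tlt t t = false. Proof. exact: plt_irr. Qed.

Lemma tlt_trans : transitive (@tlt d).
Proof. by move=> t s u; exact: plt_trans. Qed.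

Lemma tle_trans : transitive (@tle d).
Proof.
move=> t s u /orP[/eqP->//|st] /orP[/eqP<-|tu]; rewrite /tle ?st ?orbT //.
by rewrite (tlt_trans st tu) orbT.
Qed.

Lemma tle_total : total (@tle d).
Proof.
move=> s t; rewrite /tle (eq_sym t s); case: eqVneq => //= st.
by apply: plt_total; apply: contraNN st => /eqP/psort_repr_inj->.
Qed.

Lemma tle_neq_tlt s t : tle s t -> s != t -> tlt s t.
Proof. by case/orP=> // /eqP->; rewrite eqxx. Qed.

Lemma plt_NodeE (a b : E) ss ts : plt (Node a ss) (Node b ts) =
  prec_rules (@plt d) (pdeg (Node a ss)) (pdeg (Node b ts)) ss ts a b.
Proof. by []. Qed.

Lemma plt_pdeg p q : plt p q -> (pdeg p <= pdeg q)%N.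
Proof.
case: p q => [a ss] [b ts]; rewrite plt_NodeE.
by case/or4P=> [/ltnW//|/andP[/eqP->]|/and3P[/eqP->]|/and3P[/eqP->]].
Qed.

Lemma tlt_deg s t : tlt s t -> (deg s <= deg t)%N.
Proof. by move/plt_pdeg; rewrite !pdeg_psort. Qed.

Lemma tlt_Node1 a p q : tlt (pi p) (pi q) ->
  tlt (pi (Node a [:: p])) (pi (Node a [:: q])).
Proof.
rewrite !tlt_pi => pq; have := plt_pdeg pq; rewrite leq_eqVlt.
have psort1 x : psort (Node a [:: x]) = Node a [:: psort x] by [].
rewrite !psort1 plt_NodeE /prec_rules /lexlt pq /= !addn0 eqn_add2l ltn_add2l.
by case/orP=> ->; rewrite ?orbT.
Qed.

Lemma tlt_branches p q : pdeg p = pdeg q ->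
  (size (pbranches p) < size (pbranches q))%N -> tlt (pi p) (pi q).
Proof.
rewrite tlt_pi; case: p q => [a ss] [b ts] e sz.
apply/or4P; constructor 2.
rewrite !size_sort !size_map -/(psort (Node a ss)) -/(psort (Node b ts)).
by rewrite !pdeg_psort e eqxx.
Qed.

Lemma finite_seqs (T : eqType) (l : seq T) k : exists ll : seq (seq T),
  forall ts, (size ts <= k)%N -> {subset ts <= l} -> ts \in ll.
Proof.
elim: k => [|k [ll IH]]; first by exists [:: [::]] => -[].
exists ([::] :: [seq x :: xs | x <- l, xs <- ll]) => -[//|y ts] sz sub.
rewrite in_cons; apply/orP; right; apply: allpairs_f; first exact/sub/mem_head.
by apply: IH => // u uts; apply: sub; rewrite in_cons uts orbT.
Qed.

Lemma finite_gens n : exists l : seq E, forall a, (gdeg a <= n)%N -> a \in l.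
Proof.
exists (flatten [seq [seq existT _ m i | i <- enum 'I_(d m)] | m <- iota 0 n]).
move=> [m i] hm; apply/flatten_mapP; exists m; first by rewrite mem_iota.
by apply: map_f; rewrite mem_enum.
Qed.

Lemma finite_ptrees n : exists l : seq (ptree E),
  forall p, (pdeg p <= n)%N -> p \in l.
Proof.
elim: n => [|n [l IH]]; first by exists [::] => p; rewrite leqNgt pdeg_gt0.
have [gl hgl] := finite_gens n.+1; have [ll hll] := finite_seqs l n.
exists [seq Node a ts | a <- gl, ts <- ll] => -[a ts] /= le.
have a_gt0 : (0 < gdeg a)%N by [].
have {}le : (gdeg a <= n.+1)%N /\ (sumn (map (@pdeg d) ts) <= n)%N by split; lia.
apply: allpairs_f; first by apply: hgl; case: le.
case: le => _ le; apply: hll.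
  apply: leq_trans le; elim: ts => //= t ts IHts.
  by have := pdeg_gt0 t; lia.
move=> t tts; apply: IH; apply: leq_trans le.
elim: ts tts => //= u ts IHts; rewrite in_cons => /orP[/eqP->|/IHts le].
  exact: leq_addr.
exact: leq_trans le (leq_addl _ _).
Qed.

Lemma count_lt (T : eqType) (a b : pred T) (l : seq T) x :
  subpred a b -> x \in l -> ~~ a x -> b x -> (count a l < count b l)%N.
Proof.
move=> ab + ax bx; elim: l => //= y l IH; rewrite in_cons.
have aby := ab y.
case/orP=> [/eqP<-|/IH lt]; last by move: aby; case: (a y) (b y) => [] []; lia.
by rewrite (negbTE ax) bx; have := sub_count ab l; lia.
Qed.

(** A smaller tree has at most the same degree, and the trees of bounded degree
    are finite in number: the number of smaller trees decreases. *)
Lemma tlt_wf : well_founded (@tlt d).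
Proof.
move=> t; have [l hl] := finite_ptrees (deg t).
pose L := map (@Defs.pi E) l.
have hL u : (deg u <= deg t)%N -> u \in L.
  by move=> le; apply/mapP; exists (repr u); [exact: hl|rewrite /pi reprK].
suff acc k u : (deg u <= deg t)%N -> (count ((@tlt d)^~ u) L < k)%N ->
    Acc (@tlt d) u by exact: (acc _ t (leqnn _) (ltnSn _)).
elim: k u => [u _|k IH u le]; first by rewrite ltn0.
rewrite ltnS => lt.
constructor=> s su; have les := leq_trans (tlt_deg su) le.
apply: IH => //; apply: leq_trans lt; apply: (@count_lt _ _ _ _ s) => //.
- by move=> v /= vs; exact: tlt_trans vs su.
- exact: hL.
- by rewrite tlt_irr.
Qed.

Lemma seq_max (l : seq (tree E)) :
  l != [::] -> exists2 t, t \in l & forall u, u \in l -> tle u t.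
Proof.
elim: l => // t [|u l] IH _.
  by exists t; rewrite ?mem_head // => u; rewrite inE => /eqP->; rewrite /tle eqxx.
have [//|m ml hm] := IH; have /orP[tm|mt] := tle_total t m.
  exists m; first by rewrite in_cons ml orbT.
  by move=> v; rewrite in_cons => /orP[/eqP->//|]; exact: hm.
exists t; first exact: mem_head.
move=> v; rewrite in_cons => /orP[/eqP->|/hm vm]; first by rewrite /tle eqxx.
exact: tle_trans vm mt.
Qed.

End Order.

Section LeadingTerms.
Variables (K : fieldType) (d : nat -> nat).
Hypothesis charK : [pchar K] =i pred0.
Local Notation E := (gen d).
Local Notation T := {malg K[tree E]}.
Local Notation I := (preLie_ideal K d).
Implicit Types (f g : T) (t u : tree E) (p : ptree E).

Lemma ideal_span_OI f : I f -> span_trees (OI I) f -> f = 0.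
Proof.
move=> If Of; apply/eqP/negPn/negP => f0.
have [|t tf ht] := @seq_max d (msupp f).
  by apply: contraNN f0 => /eqP e; rewrite (monalgE f) e big_nil.
by apply: (Of t tf); exists f.
Qed.

Lemma smaller_TI t g :
  I (<< t >> - g) -> (forall u, u \in msupp g -> tlt u t) -> TI I t.
Proof.
move=> Itg lt; have gt : g@_t = 0.
  by apply: mcoeff_outdom; apply/negP => /lt; rewrite tlt_irr.
have ft : (<< t >> - g)@_t = 1 by rewrite mcoeffB gt subr0 mcoeffUU.
exists (<< t >> - g); split=> //.
  by apply: contra_eq_neq ft => ->; rewrite mcoeff0 eq_sym oner_neq0.
split; first by rewrite -mcoeff_neq0 ft oner_neq0.
move=> u; rewrite -mcoeff_neq0 mcoeffB mcoeffU /tle.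
case: (eqVneq u t) => //= _; rewrite sub0r oppr_eq0.
by rewrite mcoeff_neq0; exact: lt.
Qed.

Lemma TI_smaller t : TI I t -> exists2 g,
  forall u, u \in msupp g -> tlt u t & I (<< t >> - g).
Proof.
case=> f [If f0 [tf lead]]; have ft : f@_t != 0 by rewrite mcoeff_neq0.
exists (<< t >> - (f@_t)^-1 *: f); last first.
  by rewrite opprB addrC subrK; exact: idealZ.
move=> u; rewrite -mcoeff_neq0 mcoeffB mcoeffZ mcoeffU => uf.
have ut : u != t.
  by apply: contraNneq uf => ->; rewrite eqxx mulVf // subrr.
apply: (tle_neq_tlt _ ut); apply: lead; rewrite -mcoeff_neq0.
by apply: contraNneq uf => ->; rewrite mulr0 subr0 (eq_sym t) (negbTE ut).
Qed.

Lemma span_OI_stable : linear_stable (fun f => exists2 g,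
  span_trees (OI I) g & I (f - g)).
Proof.
have [h0 hD hZ] := @msupp_stable K _ (OI I).
split=> [|f f' [g hg Ig] [g' hg' Ig']|c f [g hg Ig]].
- by exists 0; [exact: h0|rewrite subrr; exact: ideal0].
- by exists (g + g'); [exact: hD|rewrite opprD addrACA; exact: idealD].
- by exists (c *: g); [exact: hZ|rewrite -scalerBr; exact: idealZ].
Qed.

Lemma span_OI_decomposition f : exists2 g, span_trees (OI I) g & I (f - g).
Proof.
apply: (msupp_ind span_OI_stable) => t _.
elim: (tlt_wf t) => {}t _ IH; have [Ot|] := pselect (OI I t).
  exists << t >>; last by rewrite subrr; exact: ideal0.
  exact: msuppU_all.
move/contrapT/TI_smaller => [g lt Itg].
have [|h hh Igh] := @msupp_ind _ _ _ g span_OI_stable; first by move=> u /lt; exact: IH.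
by exists h => //; exact: ideal_trans Itg Igh.
Qed.

(** A tree whose root has several branches is congruent to a combination of
    ladders of the same degree, which are smaller since they have fewer branches
    at the root. A tree whose root has one branch is reduced by reducing this
    branch and grafting the result on the root. *)
Lemma OI_ladder p : OI I (pi p) -> ladder p.
Proof.
elim/ptree_mem_ind: p => a [|p [|p' ps]] IH O //=.
  apply: IH; first exact: mem_head.
  move/TI_smaller => [g lt Ig]; apply: O.
  apply: (@smaller_TI _ (graft g << vertex a >>)).
    by rewrite -graft_vertex -graftBl; exact: ideal_graftr.
  apply: (@msupp_ind _ _ (fun g => forall u, u \in msupp (graft g << vertex a >>) ->
    tlt u (pi (Node a [:: p])))).
    apply: (product_stablel (@graftDl K E) (@graftZl K E)
      (J := fun f => forall u, u \in msupp f -> tlt u _)).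
    exact: msupp_stable.
  move=> u /lt; rewrite -(reprK u) -/(pi _) => up; rewrite graft_vertex.
  by apply: msuppU_all; exact: tlt_Node1.
exfalso; apply: O.
have [f hf If] := tree_ladder_comb charK (pi (Node a [:: p, p' & ps])).
apply: smaller_TI If _ => u /hf[q lq [-> dq]]; apply: tlt_branches.
  by rewrite dq deg_pi.
by case: q lq {dq} => b [|r [|]].
Qed.

End LeadingTerms.

(** * The map from the minimal section fixes ladders *)

Section PsiLadder.
Variables (K : fieldType) (d : nat -> nat).
Local Notation E := (gen d).
Implicit Types (p q : ptree E).

(** A ladder has only one planar embedding. *)
Lemma iso_ladder p q : ladder p -> iso p q -> q = p.
Proof.
elim/ptree_mem_ind: p q => a ss IH [b ts] lp /isoP[<- [us pus h]].
congr (Node a); case: ss lp IH h => [|s [|//]] lp IH h.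
  case: us pus h => // pus _; rewrite perm_sym in pus.
  exact: perm_small_eq pus.
case: us pus h => [//|u [|u' us]] pus /= /andP[su //].
rewrite perm_sym in pus; rewrite (perm_small_eq (isT : size [:: u] <= 1)%N pus).
by rewrite (IH s (mem_head _ _) u lp su).
Qed.

(** Left grafting on a one-vertex tree is the left Butcher product. *)
Lemma Psi_ladder p : ladder p -> Psi_tree K p = << p >>.
Proof.
elim/ptree_mem_ind: p => a [|p [|//]] IH //= lp.
by rewrite IH ?mem_head // /lgraft bilextU big_seq1.
Qed.

Lemma PsiSmin_ladder p : ladder p -> PsiSmin << pi p >> = << pi p >> :> {malg K[tree E]}.
Proof.
move=> lp; have [/esym/pi_isoP/(iso_ladder lp) e _] := Smin_min (pi p).
by rewrite /PsiSmin /Sminl linextU e PsiU Psi_ladder // /forget linextU.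
Qed.

End PsiLadder.

(** * The basis of the free Lie algebra *)

Section Basis.
Variables (K : fieldType) (d : nat -> nat).
Hypothesis charK : [pchar K] =i pred0.
Local Notation E := (gen d).
Local Notation T := {malg K[tree E]}.
Local Notation M := {malg K[magma E]}.
Local Notation L := (freeLie K E).
Local Notation I := (preLie_ideal K d).
Implicit Types (f g : T) (t u : tree E) (p : ptree E).

Lemma Can_span_OI f : span_trees (OI I) f -> Can f I = f.
Proof.
move=> Of; apply: xget_unique; first by split=> //; rewrite subrr; exact: ideal0.
move=> g [Og Ifg]; apply/eqP; rewrite eq_sym -subr_eq0; apply/eqP.
apply: ideal_span_OI => //.
case: (@msupp_stable K _ (OI I)) => _ hD hZ.
by apply: hD => //; rewrite -scaleN1r; exact: hZ.
Qed.

Variable Phi : {linear T -> L}.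
Hypothesis morPhi : preLie_morphism Phi.

Lemma Phi_homog t : homog (deg t) (Phi << t >>).
Proof. by have [x [hx _ /(_ _ morPhi) <-]] := beta_section charK t; exists x. Qed.

(** On homogeneous elements |x| (x |> y) is the Lie bracket, so the generators of
    the ideal are sent to [x, y] + [y, x]. *)
Lemma Phi_ideal f : I f -> Phi f = 0.
Proof.
have [Phig _] := morPhi.
have Phi_rel t u :
    Phi ((deg t)%:R *: graft << t >> << u >>) = lbr (Phi << t >>) (Phi << u >>).
  rewrite linearZ /= Phig (rhd_homog _ (Phi_homog t)) scalerA mulfV ?scale1r //.
  by rewrite natr_neq0 // pdeg_gt0.
elim=> {f} [f [s [t ->]]||f g _ Hf _ Hg|c f _ Hf|f g _ Hg|f g _ Hf].
- have anti (x y : L) : lbr x y + lbr y x = 0 by rewrite (lbrC x) addNr.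
  apply: (etrans (linearD _ _ _)).
  exact: (etrans (congr2 +%R (Phi_rel s t) (Phi_rel t s)) (anti _ _)).
- exact: linear0.
- by rewrite linearD Hf Hg addr0.
- by rewrite linearZ /= Hf scaler0.
- have r0 (x : L) : rhd x 0 = 0.
    by have := rhd_linearr (-1) 0 0 x; rewrite scaler0 add0r scaleN1r addNr.
  by rewrite Phig Hg r0.
have l0 (x : L) : rhd 0 x = 0.
  by have := rhd_linearl (-1) 0 0 x; rewrite scaler0 add0r scaleN1r addNr.
by rewrite Phig Hf l0.
Qed.

(** If [x] is a bracketing that represents Phi f, and f modulo the ideal through
    [beta], then [x] is a Lie relation as soon as Phi f = 0, and so [beta x]
    belongs to the ideal. *)
Lemma Phi_kernel f : Phi f = 0 -> I f.
Proof.
have [x Ix Px] : exists2 x : M, I (beta x - f) & lpi x = Phi f.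
  apply: (@msupp_ind _ _ (fun f => exists2 x : M, I (beta x - f) & lpi x = Phi f)).
    split=> [|g h [x Ix Px] [y Iy Py]|c g [x Ix Px]].
    - by exists 0; [rewrite beta0 subrr; exact: ideal0|rewrite lpi0 linear0].
    - exists (x + y); last by rewrite lpiD linearD Px Py.
      by rewrite betaD opprD addrACA; exact: idealD.
    - exists (c *: x); last by rewrite lpiZ linearZ Px.
      by rewrite betaZ -scalerBr; exact: idealZ.
  by move=> t _; have [x [_ Ix Px]] := beta_section charK t; exists x; last exact: Px.
move=> f0; rewrite f0 in Px; rewrite -[f]subr0.
apply: (@ideal_trans _ _ _ (beta x)); first exact: ideal_sym.
rewrite subr0; apply: (beta_ideal charK); rewrite -[x]subr0.
by apply/lie_idealP/lpiP; rewrite lpi0.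
Qed.

Lemma Phi_beta (x : M) : Phi (beta x) = lpi x.
Proof.
have [Phig Phiv] := morPhi.
apply: (@msupp_ind _ _ (fun x => Phi (beta x) = lpi x)).
  split=> [|y z hy hz|c y hy]; first by rewrite beta0 lpi0 linear0.
    by rewrite betaD lpiD linearD hy hz.
  by rewrite betaZ lpiZ linearZ /= hy.
move=> s _; rewrite betaU; elim: s => [a|l IHl r IHr] /=; first exact: Phiv.
have hl : homog (mdeg l) (lpi << l >> : L) by exists << l >> => //; exact: homU.
rewrite linearZ /= Phig IHl IHr (rhd_homog _ hl) scalerA mulfV ?scale1r.
  by rewrite lbr_pi -mmulUU.
by rewrite natr_neq0 // mdeg_gt0.
Qed.

Lemma Phi_ladder p : ladder p -> is_monomial (Phi << pi p >>).
Proof.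
have [Phig Phiv] := morPhi.
elim/ptree_mem_ind: p => a [|p [|//]] IH lp.
  by rewrite Phiv; exact: Mono_gen.
have -> : Phi << pi (Node a [:: p]) >> = rhd (Phi << pi p >>) (lgen K a).
  rewrite -graft_vertex Phig; exact: (congr1 (rhd _) (Phiv a)).
apply: Mono_rhd (Mono_gen _ _).
by apply: IH; rewrite ?mem_head.
Qed.

Lemma Phi_OI_inj f g :
  span_trees (OI I) f -> span_trees (OI I) g -> Phi f = Phi g -> f = g.
Proof.
move=> Of Og e; apply/eqP; rewrite -subr_eq0; apply/eqP.
apply: ideal_span_OI; first by apply: Phi_kernel; rewrite linearB e subrr.
case: (@msupp_stable K _ (OI I)) => _ hD hZ.
by apply: hD => //; rewrite -scaleN1r; exact: hZ.
Qed.

Lemma span_OI_U t : OI I t -> span_trees (OI I) (<< t >> : T).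
Proof. exact: msuppU_all. Qed.

Lemma malgU_inj t u : << t >> = << u >> :> T -> t = u.
Proof.
move=> e; apply: (@msuppU_all K _ (fun v => v = u) u erefl).
by rewrite -e -mcoeff_neq0 mcoeffUU oner_neq0.
Qed.

Lemma Phi_OI_basis : is_basis [set Phi << t >> | t in OI I].
Proof.
split=> [s c us Bs s0 x xs|v].
  have [t0 _ _] := Bs x xs.
  have [tau htau] : exists tau : L -> tree E, forall y, y \in s ->
      OI I (tau y) /\ Phi << tau y >> = y.
    have /choice[tau h] : forall y, exists t, y \in s -> OI I t /\ Phi << t >> = y.
      move=> y; case: (boolP (y \in s)) => [/Bs[t Ot <-]|_]; last by exists t0.
      by exists t.
    by exists tau.
  (* Lift the relation to the trees: the lift lies in the span of O(I) and in the
     kernel. *)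
  pose f : T := \sum_(y <- s) c y *: << tau y >>.
  have f0 : f = 0.
    apply: Phi_OI_inj; last first.
    - rewrite linear0 /f linear_sum /= -[RHS]s0; apply: eq_big_seq => y ys.
      by rewrite linearZ /=; have [_ ->] := htau y ys.
    - by case: (@msupp_stable K _ (OI I)).
    rewrite /f big_seq; case: (@msupp_stable K _ (OI I)) => h0 hD hZ.
    elim/big_ind: _ => // y ys; apply: hZ; apply: span_OI_U.
    by have [] := htau y ys.
  have : f@_(tau x) = \sum_(y <- s) c y * (tau y == tau x)%:R.
    rewrite /f raddf_sum; apply: eq_bigr => y _.
    by rewrite /= mcoeffZ mcoeffU.
  rewrite f0 mcoeff0 (bigD1_seq x) //= eqxx mulr1 big1_seq ?addr0 //.
  move=> y /andP[yx ys]; case: eqP => [e|_]; last by rewrite mulr0.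
  case/eqP: yx; have [_ <-] := htau y ys; have [_ <-] := htau x xs.
  by rewrite e.
have [m ->] := lpi_surj v; rewrite -Phi_beta.
have [g Og Ig] := span_OI_decomposition (beta m).
have -> : Phi (beta m) = Phi g.
  by apply/eqP; rewrite -subr_eq0 -linearB; apply/eqP/Phi_ideal.
(* The coefficient of the unique tree of O(I) sent to [x]; the default value 0
   is not taken on the family. *)
pose c (x : L) : K := xget 0 [set k | exists t,
  [/\ OI I t, Phi << t >> = x & k = g@_t]].
have cE t : OI I t -> c (Phi << t >>) = g@_t.
  move=> Ot; apply: xget_unique; first by exists t.
  move=> k [u [Ou e ->]]; congr (g@__).
  exact: malgU_inj (Phi_OI_inj (span_OI_U Ou) (span_OI_U Ot) e).
exists [seq Phi << t >> | t <- msupp g], c; split.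
  by move=> x /mapP[t tg ->]; exists t => //; exact: Og.
rewrite big_map {1}(monalgE g) linear_sum; apply: eq_big_seq => t tg.
by rewrite malgUZ linearZ /= cE //; exact: Og.
Qed.

End Basis.

Theorem theorem21 (K : fieldType) (charK : [pchar K] =i pred0)
    (d : nat -> nat) (E_nonempty : exists n, (0 < d n)%N) :
  (forall t : tree (gen d), OI (preLie_ideal K d) t ->
     PsiSmin << t >> = Can (PsiSmin << t >>) (preLie_ideal K d) /\
     Can (PsiSmin << t >>) (preLie_ideal K d) = << t >>) /\
  (forall Phi : {linear {malg K[tree (gen d)]} -> freeLie K (gen d)},
     (forall f g, Phi (graft f g) = rhd (Phi f) (Phi g)) ->
     (forall a : gen d, Phi << vertex a >> = lgen K a) ->
     monomial_basis [set Phi << t >> | t in OI (preLie_ideal K d)]).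
Proof.
have ladderP t : OI (preLie_ideal K d) t -> exists2 p, ladder p & t = pi p.
  move=> Ot; have tE : t = pi (repr t) by rewrite /pi reprK.
  by exists (repr t) => //; apply: (OI_ladder charK); rewrite -tE.
split=> [t Ot|Phi Phig Phiv].
  have -> : PsiSmin << t >> = << t >> :> {malg K[tree (gen d)]}.
    by have [p lp ->] := ladderP t Ot; exact: PsiSmin_ladder.
  by rewrite Can_span_OI //; exact: span_OI_U.
have morPhi : preLie_morphism Phi by split.
split; first exact: Phi_OI_basis.
by move=> _ [t /ladderP[p lp ->] <-]; exact: Phi_ladder.
Qed.
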